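(* Let $1\le k\le n$ be integers such that $k$ is congruent to $0$, $1$ or $-1$ modulo $d:=n/g$, where $g=\operatorname{GCD}(k,n)$; write $k=dp+c$ with $p\in\mathbb Z$, $c\in\{-1,0,1\}$ (with $c=0$ if $d=1$). Let $a_1,\dots,a_k$ be an enumeration of $[k]$ such that $\{a_{k-g+1},\dots,a_k\}=\{1,\dots,g\}$. Let $\mathcal L_1,\dots,\mathcal L_{k-p+1}$ be the collections of $k$-element subsets of $[dk]$ constructed from $(k,dk)$, $p$ and $a_1,\dots,a_k$ as in the context, let $\mathbb J=\bigcup_{s=k-g+1}^{k-p+1}\mathcal L_s$, let $F:[n]\to[dk]$ be $F(a+gx)=a+kx$ for $a\in[g]$, $0\le x\le d-1$, and let $\mathbb I'=\{F^{-1}(J): J\in\mathbb J\}$. Then $\mathbb I'$ is a symmetric maximal $(k,n)$-noncrossing collection.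
   Context: Cyclically ordered sets: a finite set $X$ with a bijection $S_X$ (successor) whose powers act transitively; $[m]=\{1,\dots,m\}$ has successor $i\mapsto i+1$ ($i<m$), $m\mapsto1$. A nonempty $Q\subseteq X$ inherits the successor $S_Q(q)=S_X^r(q)$, $r>0$ least with $S_X^r(q)\in Q$. For $a,b\in X$ the interval $[a,b]_X$ is the smallest subset containing $a,b$ with $S_X([a,b]_X\setminus\{b\})\subseteq[a,b]_X$. Subsets $I,J\subseteq[n]$ are crossing if there exist distinct $a,b,c,d$ occurring in this cyclic order around $[n]$ with $a,c\in I\setminus J$, $b,d\in J\setminus I$; otherwise noncrossing. A $(k,n)$-noncrossing collection is a collection of pairwise noncrossing $k$-element subsets of $[n]$; maximal means maximal under inclusion. For $a,b\in[m]$, $a\oplus_m b$ is $a+b$ reduced modulo $m$ into $[m]$, $I\oplus_m b=\{i\oplus_m b:i\in I\}$; a collection $\mathbb I$ of subsets of $[n]$ is symmetric if $\{I\oplus_n k:I\in\mathbb I\}=\mathbb I$. Construction in $[N]$, $N=dk$: for $a\in[N]$ put $\overline a=(a+k\mathbb Z)\cap[N]$. For $1\le s\le k-p+1$ let $P_s=[N]\setminus\bigcup_{i=1}^{s-1}\overline{a_i}$ with induced cyclic order, and for $1\le h\le d$ let $P_{s,h}=P_s\setminus\{S^m_{\overline{a_s}}(a_s): h\le m<d\}$. For $i\in[S_{P_s}(a_s\oplus_N(N-k)),a_s]_{P_s}$ put $I(i,h)=\{i,S_{P_{s,h}}(i),\dots,S_{P_{s,h}}^{k-1}(i)\}$. Let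 $B_s=\{I(i,h): i\in[S_{P_s}(a_s\oplus_N(N-k)),a_s]_{P_s},\ 1\le h\le d,\ |I(i,h)|=k\}$ and $\mathcal L_s=\{I\oplus_N xk: I\in B_s, x\in\mathbb Z\}$. *)

(* Defs.v *)
From mathcomp Require Import all_boot all_order all_algebra.

Set Implicit Arguments.
Unset Strict Implicit.
Unset Printing Implicit Defensive.

(* The cyclically ordered set [m] = {1, ..., m} is the type 'I_m, the element
   i : 'I_m standing for i + 1; its successor function is [ordS] of fintype.
   Indices of enumerations are 0-based in the same way. *)

Definition oplus (m : nat) (i : 'I_m) (b : nat) : 'I_m :=
  Ordinal (ltn_pmod (i + b) (leq_ltn_trans (leq0n i) (ltn_ord i))).

Definition oplus_set (m : nat) (I : {set 'I_m}) (b : nat) : {set 'I_m} :=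
  [set oplus i b | i in I].

(* Successor inherited by Q: the first element of Q among S q, ..., S^m q. *)
Definition succ_in (m : nat) (Q : {set 'I_m}) (q : 'I_m) : 'I_m :=
  head q [seq x <- traject (@ordS m) (ordS q) m | x \in Q].

Definition cinterval (m : nat) (Q : {set 'I_m}) (a b : 'I_m) : {set 'I_m} :=
  \bigcap_(J : {set 'I_m} | [&& J \subset Q, a \in J, b \in J
                              & succ_in Q @: (J :\ b) \subset J]) J.

Definition cyclic4 (m : nat) (a b c d : 'I_m) : bool :=
  [|| [&& a < b, b < c & c < d], [&& b < c, c < d & d < a],
      [&& c < d, d < a & a < b] | [&& d < a, a < b & b < c]].

Definition crossing (n : nat) (I J : {set 'I_n}) : bool :=
  [exists a in I :\: J, exists b in J :\: I,
   exists c in I :\: J, exists d in J :\: I, cyclic4 a b c d].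

Definition noncrossing_collection (k n : nat) (C : {set {set 'I_n}}) : bool :=
  [forall I in C, #|I| == k]
  && [forall I in C, forall J in C, ~~ crossing I J].

Definition maximal_noncrossing_collection (k n : nat)
    (C : {set {set 'I_n}}) : bool :=
  maxset (@noncrossing_collection k n) C.

Definition symmetric_collection (k n : nat) (C : {set {set 'I_n}}) : Prop :=
  [set oplus_set I k | I in C] = C.

Section Construction.

Variables (d k : nat) (a : 'I_k -> 'I_(d * k)).

Definition bar (x : 'I_(d * k)) : {set 'I_(d * k)} :=
  [set y : 'I_(d * k) | y == x %[mod k]].

Definition Pset (s : 'I_k) : {set 'I_(d * k)} :=
  ~: \bigcup_(i : 'I_k | i < s) bar (a i).

Definition Pset_h (s : 'I_k) (h : nat) : {set 'I_(d * k)} :=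
  Pset s :\: [set iter m (succ_in (bar (a s))) (a s) | m : 'I_d & h <= m].

Definition Iset (s : 'I_k) (i : 'I_(d * k)) (h : nat) : {set 'I_(d * k)} :=
  [set x in traject (succ_in (Pset_h s h)) i k].

Definition start_interval (s : 'I_k) : {set 'I_(d * k)} :=
  cinterval (Pset s) (succ_in (Pset s) (oplus (a s) (d * k - k))) (a s).

Definition Bcoll (s : 'I_k) : {set {set 'I_(d * k)}} :=
  \bigcup_(1 <= h < d.+1)
    [set Iset s i h | i in start_interval s & #|Iset s i h| == k].

(* Translation by x * k depends only on x modulo d, so x < d replaces
   x ranging over all integers. *)
Definition Lcoll (s : 'I_k) : {set {set 'I_(d * k)}} :=
  \bigcup_(x < d) [set oplus_set I (x * k) | I in Bcoll s].

(* The union of the collections of (1-based) index k-g+1, ..., k-p+1.  The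
   upper index exceeds k only when p = 0; the extra index k+1 contributes
   nothing, since the set left after removing all the classes is empty. *)
Definition Jcoll (g : nat) (p : int) : {set {set 'I_(d * k)}} :=
  \bigcup_(s : 'I_k | (k - g <= s)
                      && ((s : nat)%:Z <= k%:Z - p)%R) Lcoll s.

End Construction.

(* Main.v *)
(* The sets of the construction are the k-element sets consisting of the elements
   of P_s up to some position of an arc of the circle, and of the elements of
   P_(s+1) from there to the end of the arc; they form the arc family.  Two such
   sets are always separated by an arc, whence noncrossingness.

   Maximality is proved directly.  Let X be a k-element set crossing no member
   of the family, let s be the least rank occurring in X and let B be the class
   P_s \ P_(s+1), so that X meets B.  Crossing arguments against members of the
   family show that X and B meet inside a single gap (m1, m2) of the set
   P_(s+1) \ X, that X lies entirely in this gap, and that the elements of B in X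
   form an initial segment of those of the gap; hence X is itself in the family.
   The congruence condition on k enters only through |P_(s+1)| >= k - 1, which
   can fail only if |P_s| <= k + 1, when every k-element subset of P_s is in the
   family. *)
Require Import Defs.
From mathcomp Require Import all_boot all_order all_algebra.
From mathcomp Require Import zify.

Set Implicit Arguments.
Unset Strict Implicit.
Unset Printing Implicit Defensive.

(** * Cyclic distance and crossings *)

(** A cyclic order has no origin, so each argument cuts the circle at a point suited to it and reads
    positions as [dist N i z]; changing the cut costs a case split on one extra turn, and the rest
    is linear arithmetic.

    Every contradiction needs a test set with exactly [k] elements and prescribed points in and out.
    Such sets come from windows whose bounds move one position at a time: the size changes by at
    most one at each move and so attains [k]. The obstacle is that P_(s+1) may be too small to hold
    a test set that omits a given point. The test set must then borrow elements of B, which belong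
    to X as well; a count shows that it cannot contain all those of X, and a missed one provides the
    alternation. This is why the crossing lemmas split on the size of P_(s+1), with k - 1 as the
    extreme case. *)

Definition dist (N i z : nat) : nat := if i <= z then z - i else z + N - i.

Lemma distE N i z :
  (i <= z /\ dist N i z = z - i) \/ (z < i /\ dist N i z = z + N - i).
Proof. by rewrite /dist; case: leqP => H; [left|right]. Qed.

Section Dist.

Variable N : nat.
Implicit Types (i j x y z : 'I_N).

Lemma dist_inj i x y : dist N i x = dist N i y -> x = y.
Proof.
move=> h; apply: ord_inj; move: h (ltn_ord i) (ltn_ord x) (ltn_ord y).
case: (distE N i x) => [[h1 ->]|[h1 ->]];
case: (distE N i y) => [[h2 ->]|[h2 ->]]; lia.
Qed.

Lemma distii i : dist N i i = 0.
Proof. by rewrite /dist leqnn subnn. Qed.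

Lemma dist_lt i z : dist N i z < N.
Proof.
by move: (ltn_ord i) (ltn_ord z); case: (distE N i z) => [[h1 ->]|[h1 ->]]; lia.
Qed.

(** A detour through [j] costs at most one extra turn. With [dist_lt], this is how a cut is changed
    before calling [lia]. *)
Lemma dist_shift i j z :
  dist N i j + dist N j z = dist N i z \/
  dist N i j + dist N j z = dist N i z + N.
Proof.
move: (ltn_ord i) (ltn_ord z) (ltn_ord j).
case: (distE N i j) => [[h1 ->]|[h1 ->]];
case: (distE N i z) => [[h2 ->]|[h2 ->]];
case: (distE N j z) => [[h3 ->]|[h3 ->]]; lia.
Qed.

Lemma dist_sym i j : i != j -> dist N j i = N - dist N i j.
Proof.
move=> /eqP ij; have {}ij : nat_of_ord i <> j by move=> /val_inj.
move: (ltn_ord i) (ltn_ord j).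
case: (distE N i j) => [[h1 ->]|[h1 ->]];
case: (distE N j i) => [[h3 ->]|[h3 ->]]; lia.
Qed.

End Dist.

Lemma cyclic4P n (a b c d : 'I_n) : reflect
  [\/ a < b /\ b < c /\ c < d, b < c /\ c < d /\ d < a,
      c < d /\ d < a /\ a < b | d < a /\ a < b /\ b < c] (cyclic4 a b c d).
Proof.
have E (p q r : bool) : [&& p, q & r] <-> p /\ q /\ r.
  by split=> [/and3P[]|[? []]] *; [|apply/and3P].
by apply: (iffP or4P) => -[/E h|/E h|/E h|/E h]; [constructor 1|constructor 2
  |constructor 3|constructor 4|constructor 1|constructor 2|constructor 3|constructor 4].
Qed.

Lemma crossingP n (I J : {set 'I_n}) : reflect
  (exists a b c d, [/\ a \in I :\: J, b \in J :\: I, c \in I :\: J,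
     d \in J :\: I & cyclic4 a b c d]) (crossing I J).
Proof.
apply: (iffP idP) => [h|[a [b [c [d [aI bJ cI dJ h]]]]]].
  move/exists_inP: h => [a aI h]; move/exists_inP: h => [b bI h].
  move/exists_inP: h => [c cI h]; move/exists_inP: h => [d dI h].
  by exists a, b, c, d.
apply/exists_inP; exists a => //; apply/exists_inP; exists b => //.
by apply/exists_inP; exists c => //; apply/exists_inP; exists d.
Qed.

Section Crossing.

Variable N : nat.
Implicit Types (i a b c d x y z : 'I_N) (I J X : {set 'I_N}).

Lemma crossing_cut i I J a b c d :
  a \in I :\: J -> b \in J :\: I -> c \in I :\: J -> d \in J :\: I ->
  dist N i a < dist N i b -> dist N i b < dist N i c ->
  dist N i c < dist N i d -> crossing I J.
Proof.
move=> aI bJ cI dJ h1 h2 h3.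
apply/crossingP; exists a, b, c, d; split=> //; apply/cyclic4P; move: h1 h2 h3 (ltn_ord a) (ltn_ord b) (ltn_ord c) (ltn_ord d).
clear.
case: (distE N i a) => [[? ->]|[? ->]];
case: (distE N i b) => [[? ->]|[? ->]];
case: (distE N i c) => [[? ->]|[? ->]];
case: (distE N i d) => [[? ->]|[? ->]] => *;
first [constructor 1; lia|constructor 2; lia|constructor 3; lia|constructor 4; lia].
Qed.

Lemma crossing_sym I J : crossing I J = crossing J I.
Proof.
have imp : forall K L : {set 'I_N}, crossing K L -> crossing L K.
  move=> K L /crossingP[a [b [c [d [aI bJ cI dJ h]]]]].
  apply/crossingP; exists b, c, d, a; split=> //.
  by move: h; rewrite /cyclic4; case/or4P => ->; rewrite ?orbT.
by apply/idP/idP; apply: imp.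
Qed.

(** Four points alternating between the two differences would have to enter and leave the arc of
    length [l] from [i] twice. *)
Lemma not_crossing_arc I J i l :
  (forall z, z \in I -> z \notin J -> dist N i z < l) ->
  (forall z, z \in J -> z \notin I -> l <= dist N i z) -> ~~ crossing I J.
Proof.
move=> hI hJ; apply/negP => /crossingP[a [b [c [d []]]]].
move=> /setDP[/hI ha /ha {}ha] /setDP[/hJ hb /hb {}hb].
move=> /setDP[/hI hc /hc {}hc] /setDP[/hJ hd /hd {}hd] /cyclic4P h.
move: ha hb hc hd h (ltn_ord a) (ltn_ord b) (ltn_ord c) (ltn_ord d) (ltn_ord i).
clear.
case: (distE N i a) => [[? ->]|[? ->]];
case: (distE N i b) => [[? ->]|[? ->]];
case: (distE N i c) => [[? ->]|[? ->]];
case: (distE N i d) => [[? ->]|[? ->]] => ? ? ? ?; case; lia.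
Qed.

End Crossing.

(* [P_s] up to the [l1]-th position after [i], then [P_(s+1)] up to the
   [l2]-th, where [P_s] is the set of elements of rank at least [s]. *)
Definition arcset N (rho : 'I_N -> nat) (s : nat) (i : 'I_N) (l1 l2 : nat) :
    {set 'I_N} :=
  [set z | [&& s <= rho z, dist N i z < l2 & (rho z == s) ==> (dist N i z < l1)]].

Lemma arcsetP N (rho : 'I_N -> nat) s (i : 'I_N) l1 l2 z : reflect
  (s <= rho z /\ dist N i z < l2 /\ (rho z = s -> dist N i z < l1))
  (z \in arcset rho s i l1 l2).
Proof.
rewrite inE; apply: (iffP and3P) => [[h1 h2 /implyP h3]|[h1 [h2 h3]]].
  by split=> //; split=> // /eqP/h3.
by split=> //; apply/implyP => /eqP/h3.
Qed.

Lemma in_arcset N (rho : 'I_N -> nat) s (i : 'I_N) l1 l2 z :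
  (z \in arcset rho s i l1 l2) =
  (if rho z == s then (dist N i z < l1) && (dist N i z < l2)
   else (s < rho z) && (dist N i z < l2)).
Proof.
rewrite inE; case: (altP eqP) => [->|h]; first by rewrite leqnn /= andbC.
by rewrite implyFb andbT [s < _]ltn_neqAle (eq_sym s) (negbTE h).
Qed.

(** Normalises the bounds to the range [l1 <= l2 <= N] in which separating arcs are computed. *)
Lemma arcset_min N (rho : 'I_N -> nat) s (i : 'I_N) l1 l2 :
  arcset rho s i l1 l2 = arcset rho s i (minn l1 (minn l2 N)) (minn l2 N).
Proof.
apply/setP => z; have zN := dist_lt i z.
by apply/arcsetP/arcsetP; move: (dist N i z) zN => *; lia.
Qed.

(** [s0] becomes [k - g], so that members live on the image of [F]. No upper bound is put on [s]:
    cardinality supplies the one in [Jcoll]. *)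
Definition arc_family N (rho : 'I_N -> nat) (k s0 : nat) (I : {set 'I_N}) : Prop :=
  #|I| = k /\ exists s i l1 l2, s0 <= s /\ I = arcset rho s i l1 l2.

(* Seen from [i], the arc of the second set starts at [e := dist i j]; the
   hypothesis [e <= l1 \/ e + m1 <= N] holds after exchanging the two sets if
   necessary, and each case exhibits a separating arc. *)
Lemma arcset_not_crossing_aux N (rho : 'I_N -> nat) s (i j : 'I_N) l1 l2 m1 m2 :
  l1 <= l2 -> l2 <= N -> m1 <= m2 -> m2 <= N ->
  dist N i j <= l1 \/ dist N i j + m1 <= N ->
  ~~ crossing (arcset rho s i l1 l2) (arcset rho s j m1 m2).
Proof.
have := dist_lt i j; move eqe : (dist N i j) => e eN l12 l2N m12 m2N C.
have [h1|h1] := ltnP (e + m1) l1; last have [h2|h2] := ltnP (e + m2) l2;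
  last have [h3|h3] := leqP (e + m2) (l2 + N).
- apply: (@not_crossing_arc _ _ _ i l2) => z; rewrite !in_arcset;
  move: (dist_lt i z) (dist_lt j z) (dist_shift i j z); rewrite eqe;
  move: (dist N i z) (dist N j z) => x y; case: (rho z == s);
  case: (s < rho z) => //=; rewrite ?negb_and -?leqNgt;
  (move=> ? ? [?|?] /andP[? ?] /orP[?|?] || move=> ? ? [?|?] ? ?); lia.
- rewrite crossing_sym; apply: (@not_crossing_arc _ _ _ j m2) => z; rewrite !in_arcset;
  move: (dist_lt i z) (dist_lt j z) (dist_shift i j z); rewrite eqe;
  move: (dist N i z) (dist N j z) => x y; case: (rho z == s);
  case: (s < rho z) => //=; rewrite ?negb_and -?leqNgt;
  (move=> ? ? [?|?] /andP[? ?] /orP[?|?] || move=> ? ? [?|?] ? ?); lia.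
- by case: C => C; apply: (@not_crossing_arc _ _ _ i e) => z; rewrite !in_arcset;
  move: (dist_lt i z) (dist_lt j z) (dist_shift i j z); rewrite eqe;
  move: (dist N i z) (dist N j z) => x y; case: (rho z == s);
  case: (s < rho z) => //=; rewrite ?negb_and -?leqNgt;
  (move=> ? ? [?|?] /andP[? ?] /orP[?|?] || move=> ? ? [?|?] ? ?); lia.
- have [h4|h4] := leqP l1 e; apply: (@not_crossing_arc _ _ _ i (if l1 <= e then l1 else e)); rewrite (leqNgt l1) ?h4 ?(leq_gtF h4) /= => z; rewrite !in_arcset;
  move: (dist_lt i z) (dist_lt j z) (dist_shift i j z); rewrite eqe;
  move: (dist N i z) (dist N j z) => x y; case: (rho z == s);
  case: (s < rho z) => //=; rewrite ?negb_and -?leqNgt;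
  (move=> ? ? [?|?] /andP[? ?] /orP[?|?] || move=> ? ? [?|?] ? ?); lia.
Qed.

Lemma arcset_not_crossing N (rho : 'I_N -> nat) s (i j : 'I_N) l1 l2 m1 m2 :
  ~~ crossing (arcset rho s i l1 l2) (arcset rho s j m1 m2).
Proof.
rewrite (arcset_min _ _ i) (arcset_min _ _ j).
have H2 := geq_minr l2 N; have M2 := geq_minr m2 N.
have H1 := geq_minr l1 (minn l2 N); have M1 := geq_minr m1 (minn m2 N).
have [h1|h1] := leqP (dist N i j) (minn l1 (minn l2 N)).
  by apply: arcset_not_crossing_aux => //; left.
have [h2|h2] := leqP (dist N i j + minn m1 (minn m2 N)) N.
  by apply: arcset_not_crossing_aux => //; right.
(* Here the rank-[s] part of the second arc wraps past [i], so seen from [j] the point [i] lies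
   within it: the first alternative holds after the exchange. *)
have ij : i != j by apply: contraL h1 => /eqP->; rewrite distii -leqNgt.
rewrite crossing_sym; apply: arcset_not_crossing_aux => //.
by left; rewrite dist_sym // leq_subLR ltnW.
Qed.

(** For [s < t], the first set contains everything of rank above [s] in its arc, so what the second
    has beyond the first lies outside this arc. *)
Lemma arc_family_not_crossing N (rho : 'I_N -> nat) k s0 I J :
  arc_family rho k s0 I -> arc_family rho k s0 J -> ~~ crossing I J.
Proof.
move=> [_ [s [i [l1 [l2 [_ ->]]]]]] [_ [t [j [m1 [m2 [_ ->]]]]]] {I J}.
wlog st : s i l1 l2 t j m1 m2 / s <= t.
  move=> H; case: (leqP s t) => [/H //|/ltnW/H]; by rewrite crossing_sym.
case: (ltngtP s t) st => // [st _|<-{t} _]; last exact: arcset_not_crossing.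
apply: (@not_crossing_arc _ _ _ i l2) => z.
  by move=> /arcsetP[_ []].
move=> /arcsetP[tz _] /arcsetP h; rewrite leqNgt; apply/negP => h2; apply: h.
by split; [lia|split=> //; lia].
Qed.

(** * Sets crossing no member of an arc family *)

(** Discrete intermediate value theorem; it produces all the test sets of size exactly [k]. *)
Lemma card_ivt (T : finType) (G : nat -> {set T}) n k :
  (forall j, #|G j.+1| <= #|G j|.+1) -> #|G 0| <= k -> k <= #|G n| ->
  exists2 j, j <= n & #|G j| = k.
Proof.
move=> hG h0; elim: n => [|n IHn] hn.
  by exists 0 => //; apply/eqP; rewrite eqn_leq h0.
case: (leqP k #|G n|) => [/IHn[j jn <-]|kn]; first by exists j => //; apply: leqW.
by exists n.+1 => //; apply/eqP; rewrite eqn_leq hn andbT (leq_trans (hG n)).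
Qed.

Lemma card_step (T : finType) (A B : {set T}) :
  (forall x y, x \in B -> x \notin A -> y \in B -> y \notin A -> x = y) ->
  #|B| <= #|A|.+1.
Proof.
move=> h; rewrite -(cardsID A B) -addn1 leq_add ?subset_leq_card ?subsetIr //.
by apply/card_le1_eqP => x y /setDP[xB xA] /setDP[yB yA]; apply: h.
Qed.

Lemma exists_dist N (w : 'I_N) a : a < N -> exists i : 'I_N, dist N w i = a.
Proof.
move=> aN; have wN := ltn_ord w; have [h|h] := ltnP (w + a) N.
  by exists (Ordinal h); rewrite /dist /= leq_addr addKn.
have h' : w + a - N < N by lia.
exists (Ordinal h'); rewrite /dist /= leqNgt (_ : w + a - N < w) /=; lia.
Qed.

(* An arc set in the positions counted from a cut [w] of the circle that the arc
   does not straddle (for [b <= N]). *)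
Definition window N (rho : 'I_N -> nat) (s : nat) (w : 'I_N) (a c b : nat) :
    {set 'I_N} :=
  [set z | [&& s <= rho z, a <= dist N w z, dist N w z < b
             & (rho z == s) ==> (dist N w z < c)]].

Lemma windowP N (rho : 'I_N -> nat) s (w : 'I_N) a c b z : reflect
  [/\ s <= rho z, a <= dist N w z, dist N w z < b & rho z = s -> dist N w z < c]
  (z \in window rho s w a c b).
Proof.
rewrite inE; apply: (iffP and4P) => -[h1 h2 h3 h4]; split=> //.
  by move/eqP=> h; move/implyP: h4; apply.
by apply/implyP => /eqP.
Qed.

Lemma window_arcset N (rho : 'I_N -> nat) s (w : 'I_N) a c b : b <= N ->
  exists i l1 l2, window rho s w a c b = arcset rho s i l1 l2.
Proof.
move=> bN; have [ba|ab] := leqP b a.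
  exists w, 0, 0; apply/setP => z; apply/windowP/arcsetP; last by case=> ? [].
  by case=> _ h1 h2; have := leq_trans h2 ba; rewrite ltnNge h1.
have [i ia] := exists_dist w (leq_trans ab bN).
exists i, (c - a), (b - a); apply/setP => z.
move: (dist_shift w i z) (dist_lt i z) (dist_lt w z); rewrite ia.
move=> h1 h2 h3; apply/windowP/arcsetP.
  move=> [h4 h5 h6 h7]; split=> //; have {h1} h1 : a + dist N i z = dist N w z by lia.
  by split; [lia|move=> /h7; lia].
move=> [h4 [h5 h6]]; have {h1} h1 : a + dist N i z = dist N w z by lia.
by split=> //; [lia|lia|move=> /h6; lia].
Qed.

Section Maximal.

Variables (N : nat) (rho : 'I_N -> nat) (k s0 s : nat).
Hypothesis s0s : s0 <= s.
(** To be instantiated by [rank_interleave]: between two elements of one residue class modulo [k],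
    every other class occurs. *)
Hypothesis interleave : forall w x y z : 'I_N,
  rho x = rho y -> rho z <> rho x -> dist N w x < dist N w y ->
  exists z', [/\ rho z' = rho z, dist N w x < dist N w z'
                & dist N w z' < dist N w y].

Implicit Types (w x y z p v m : 'I_N) (I X : {set 'I_N}).

Local Notation P0 := [set z | s <= rho z].
Local Notation P1 := [set z | s < rho z].
Local Notation D := (dist N).

Lemma window_family w a c b :
  b <= N -> #|window rho s w a c b| = k ->
  arc_family rho k s0 (window rho s w a c b).
Proof.
move=> bN h; split=> //; have [i [l1 [l2 ->]]] := window_arcset rho s w a c bN.
by exists s, i, l1, l2.
Qed.

Lemma dist0 w z : D w z = 0 -> z = w.
Proof. by rewrite -(distii w) => /dist_inj. Qed.

Lemma dist_gt0 w z : z != w -> 0 < D w z.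
Proof. by rewrite lt0n; apply: contra => /eqP /dist0 ->. Qed.

(** The stretch from [lo] to [hi] is enlarged upwards to the end of the circle and, if this is not
    enough, downwards to position 1, so never reaching [w]. The bound [c = 0] discards rank [s]. *)
Lemma window_grow w lo hi :
  0 < lo -> hi < N -> k <= #|P1 :\ w| ->
  #|[set z in P1 | lo <= D w z <= hi]| <= k ->
  exists I, [/\ arc_family rho k s0 I, I \subset P1 :\ w
    & forall z, s < rho z -> lo <= D w z <= hi -> z \in I].
Proof.
move=> lo0 hiN kP kW.
have wP a b : 0 < a -> window rho s w a 0 b \subset P1 :\ w.
  move=> a0; apply/subsetP => z /windowP[h1 h2 h3 h4]; rewrite !inE ltn_neqAle h1.
  rewrite andbT; apply/andP; split; last by apply/eqP => /esym/h4.
  by apply: contraTneq h2 => ->; rewrite distii -ltnNge.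
have [kr|kr] := leqP k #|window rho s w lo 0 N|.
  have [|||j jN hj] := @card_ivt _ (fun j => window rho s w lo 0 (minn N (hi + j.+1))) N k.
  - move=> j; apply: card_step => x y /windowP[x1 x2 x3 x4] /windowP x5.
    move=> /windowP[y1 y2 y3 y4] /windowP y5.
    have x6 : ~ D w x < minn N (hi + j.+1) by move=> h; apply: x5.
    have y6 : ~ D w y < minn N (hi + j.+1) by move=> h; apply: y5.
    apply: (@dist_inj _ w); move: x3 x6 y3 y6; rewrite !leq_min; lia.
  - apply: leq_trans kW; apply/subset_leq_card/subsetP => z /windowP[h1 h2 h3 h4].
    rewrite !inE h2 /= andbC; move: h3; rewrite leq_min addn1 ltnS => /andP[_ ->] /=.
    by rewrite ltn_neqAle h1 andbT; apply/eqP => /esym/h4.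
  - by rewrite (minn_idPl _) // addnS; lia.
  exists (window rho s w lo 0 (minn N (hi + j.+1))); split.
  - exact: (window_family (geq_minl _ _) hj).
  - exact: wP.
  - move=> z zP /andP[h1 h2]; apply/windowP; split=> //; first exact: ltnW.
      by rewrite leq_min dist_lt /=; lia.
    by move=> e; rewrite e ltnn in zP.
have [|||j jN hj] := @card_ivt _ (fun j => window rho s w (maxn 1 (lo - j)) 0 N) lo k.
- move=> j; apply: card_step => x y /windowP[x1 x2 x3 x4] /windowP x5.
  move=> /windowP[y1 y2 y3 y4] /windowP y5.
  have x6 : ~ maxn 1 (lo - j) <= D w x by move=> h; apply: x5.
  have y6 : ~ maxn 1 (lo - j) <= D w y by move=> h; apply: y5.
  apply: (@dist_inj _ w); move: x2 x6 y2 y6; rewrite !geq_max; lia.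
- by rewrite subn0 (maxn_idPr _) // ltnW.
- apply: leq_trans kP _; apply/subset_leq_card/subsetP => z /setD1P[zw].
  rewrite inE => zP; apply/windowP; split; [exact: ltnW| |exact: dist_lt|].
    by rewrite subnn dist_gt0.
  by move=> e; rewrite e ltnn in zP.
exists (window rho s w (maxn 1 (lo - j)) 0 N); split.
- exact: (window_family (leqnn _) hj).
- by apply: wP; rewrite leq_max.
- move=> z zP /andP[h1 h2]; apply/windowP; split=> //; first exact: ltnW.
  + by rewrite geq_max (leq_trans lo0 h1) (leq_trans (leq_subr _ _)).
  + exact: dist_lt.
  + by move=> e; rewrite e ltnn in zP.
Qed.

(** Companion of [window_grow] for a small [P1]: all of [P1 :\ v] is kept, and elements of rank [s]
    are added by increasing distance from [v] until there are [k]. *)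
Lemma window_fill v :
  #|P1 :\ v| <= k -> k <= #|P0 :\ v| ->
  exists2 c, #|window rho s v 1 c N| = k & arc_family rho k s0 (window rho s v 1 c N).
Proof.
move=> k1 k0; have [|||c cN hc] := @card_ivt _ (fun c => window rho s v 1 c N) N k.
- move=> j; apply: card_step => x y /windowP[x1 x2 x3 x4] /windowP x5.
  move=> /windowP[y1 y2 y3 y4] /windowP y5.
  case: (altP (rho x =P s)) => [xs|/eqP xs]; last by case: x5; split.
  case: (altP (rho y =P s)) => [ys|/eqP ys]; last by case: y5; split.
  have {x4} x4 := x4 xs; have {y4} y4 := y4 ys.
  have x6 : ~ D v x < j by move=> h; apply: x5.
  have y6 : ~ D v y < j by move=> h; apply: y5.
  by apply: (@dist_inj _ v); lia.
- apply: leq_trans k1; apply/subset_leq_card/subsetP => z /windowP[h1 h2 h3 h4].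
  rewrite !inE ltn_neqAle h1 andbT; apply/andP; split; last by apply/eqP => /esym/h4.
  by apply: contraTneq h2 => ->; rewrite distii.
- apply: leq_trans k0 _; apply/subset_leq_card/subsetP => z /setD1P[zw].
  by rewrite inE => zP; apply/windowP; split; rewrite ?dist_gt0 ?dist_lt.
by exists c => //; apply: window_family.
Qed.

Lemma family_setU1 (b : 'I_N) : rho b = s -> #|P1|.+1 = k -> arc_family rho k s0 (b |: P1).
Proof.
move=> bs hk.
(* With the cut at [b], the bound 1 leaves only position 0 to rank [s]. *)
have E : window rho s b 0 1 N = b |: P1.
  apply/setP => z; apply/windowP/setU1P => [[h1 _ h3 h4]|[->|]].
  - case: (altP (rho z =P s)) => [/h4|zs]; last by right; rewrite inE ltn_neqAle eq_sym zs.
    by rewrite ltnS leqn0 => /eqP /dist0; left.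
  - by split=> [|||]; rewrite ?bs ?distii ?(leq_ltn_trans _ (ltn_ord b)).
  - rewrite inE => zP; split=> //; [exact: ltnW|exact: dist_lt|].
    by move=> e; rewrite e ltnn in zP.
rewrite -E; apply: window_family; rewrite // E cardsU1 -hk.
by rewrite inE bs ltnn.
Qed.

(** Either [X] is all of [P0], or it omits a single [v]; cutting at [v] and starting at position 1
    then makes it a window. *)
Lemma codim1_family (X : {set 'I_N}) : X != set0 ->
  #|X| = k -> X \subset P0 -> #|P0| <= k.+1 -> arc_family rho k s0 X.
Proof.
move=> /set0Pn[x xX] cX XP0 cP0.
have XP z : z \in X -> s <= rho z by move/(subsetP XP0); rewrite inE.
have [P0X|] := boolP (P0 \subset X).
  have XE : X = window rho s x 0 N N.
    apply/setP => z; apply/idP/windowP => [zX|[h1 _ _ _]].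
      by split; rewrite ?dist_lt ?XP.
    by apply: (subsetP P0X); rewrite inE.
  by rewrite XE; apply: window_family; rewrite // -XE.
case/subsetPn => v; rewrite inE => vP vX.
have VX : v |: X = P0.
  apply/eqP; rewrite eqEcard cardsU1 vX cX cP0 andbT.
  by apply/subsetP => z /setU1P[->|/XP]; rewrite inE.
have XE : X = window rho s v 1 N N.
  apply/setP => z; apply/idP/windowP => [zX|[h1 h2 _ _]].
    split; rewrite ?dist_lt ?XP //; apply: dist_gt0.
    by apply: contraNneq vX => <-.
  have : z \in P0 by rewrite inE.
  by rewrite -VX => /setU1P[zv|//]; rewrite zv distii in h2.
by rewrite XE; apply: window_family; rewrite // -XE.
Qed.

(** * A fixed [k]-element set crossing no member of the family *)

Section NonCrossing.

Variable X : {set 'I_N}.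
Hypothesis cardX : #|X| = k.
Hypothesis XP0 : X \subset P0.
Hypothesis card_P1 : k <= #|P1|.+1.
Hypothesis X_noncrossing : forall I, arc_family rho k s0 I -> ~~ crossing X I.

Local Notation XB := (X :&: [set z | rho z == s]).

Lemma X_rank z : z \in X -> s <= rho z.
Proof. by move/(subsetP XP0); rewrite inE. Qed.

Lemma no_alternation I w (a b c d : 'I_N) : arc_family rho k s0 I ->
  a \in X -> a \notin I -> b \in I -> b \notin X ->
  c \in X -> c \notin I -> d \in I -> d \notin X ->
  D w a < D w b -> D w b < D w c -> D w c < D w d -> False.
Proof.
move=> hI aX aI bI bX cX cI dI dX h1 h2 h3; apply/negP: (X_noncrossing hI).
by rewrite (@crossing_cut _ w _ _ a b c d) // inE ?aI ?bX ?cI ?dX.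
Qed.

Lemma no_alternation_r I w (a b c d : 'I_N) : arc_family rho k s0 I ->
  a \in I -> a \notin X -> b \in X -> b \notin I ->
  c \in I -> c \notin X -> d \in X -> d \notin I ->
  D w a < D w b -> D w b < D w c -> D w c < D w d -> False.
Proof.
move=> hI aI aX bI bX cI cX dI dX h1 h2 h3; apply/negP: (X_noncrossing hI).
by rewrite crossing_sym (@crossing_cut _ w _ _ a b c d) // inE ?aX ?bX ?cX ?dX.
Qed.

Lemma neq_rho x y : s < rho x -> rho y = s -> x != y.
Proof. by move=> h1 h2; apply: contraTneq h1 => ->; rewrite h2 ltnn. Qed.

(* If [b'] is the first element of [B] after [p] missing from [X], then the set of
   the family starting right after [p] and losing [B] right after [b'] crosses [X].
   When [P1] is too small for it to have [k] elements, [b' |: P1] or a set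
   containing exactly two elements of [B] does. *)
Lemma no_gap_below p m (b' b : 'I_N) :
  p \in X -> s < rho p -> m \notin X -> s < rho m ->
  (forall z, s < rho z -> D p z < D p m -> z \in X) ->
  b' \notin X -> rho b' = s -> b \in X -> rho b = s ->
  D p b' < D p b -> D p b < D p m -> False.
Proof.
move=> pX pP mX mP pmX b'X b's bX bs b'b bm.
have Pb' : (rho b' == s) && (b' \notin X) by rewrite b's eqxx.
have [b1 /andP[/eqP b1s b1X] b1min] :=
  @arg_minnP _ b' (fun z => (rho z == s) && (z \notin X)) (D p) Pb'.
have {b'X b's b'b} b1b : D p b1 < D p b := leq_ltn_trans (b1min b' Pb') b'b.
have mp : m != p by apply: contraNneq mX => ->.
have b1p : b1 != p by rewrite eq_sym neq_rho.
have bp : b != p by rewrite eq_sym neq_rho.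
have b1m : D p b1 < D p m := ltn_trans b1b bm.
have cardXpb : #|X :\ p :\ b|.+2 = k.
  by rewrite -cardX (cardsD1 p X) pX (cardsD1 b (X :\ p)) !inE bp bX.
have cardP1p : #|P1 :\ p|.+1 = #|P1| by rewrite (cardsD1 p P1) inE pP.
have b1P1p : b1 \notin P1 :\ p by rewrite !inE b1s ltnn andbF.
set c := (D p b1).+1.
have [kW|Wk] := leqP k #|window rho s p 1 c N|.
  have [|||j jN hj] := @card_ivt _ (fun j => window rho s p 1 c j) N k => //.
  - move=> j; apply: card_step => x y /windowP[x1 x2 x3 x4] /windowP x5.
    move=> /windowP[y1 y2 y3 y4] /windowP y5.
    have x6 : ~ D p x < j by move=> h; apply: x5.
    have y6 : ~ D p y < j by move=> h; apply: y5.
    by apply: (@dist_inj _ p); move: x3 x6 y3 y6; clear; lia.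
  - by rewrite (_ : window _ _ _ _ _ _ = set0) ?cards0 //; apply/setP => z;
       rewrite [RHS]inE; apply/negbTE/negP => /windowP[].
  (* If the window did not reach [m], it would lie in [X] with [p] and [b] traded for [b1], which
     has at most [k - 1] elements. *)
  have mj : D p m < j.
    rewrite ltnNge; apply/negP => jm; suff : k < k by rewrite ltnn.
    rewrite -{1}hj -cardXpb ltnS; apply: (@leq_trans #|b1 |: (X :\ p :\ b)|).
      apply/subset_leq_card/subsetP => z /windowP[h1 h2 h3 h4]; rewrite !inE.
      have zp : z != p by apply: contraTneq h2 => ->; rewrite distii.
      case: (altP (z =P b1)) => //= zb1; rewrite zp /=.
      case: (altP (rho z =P s)) => [zs|zs].
        have zc := h4 zs; rewrite (_ : z != b) /=.
          apply: contraTT zc => zX; rewrite -leqNgt ltn_neqAle.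
          rewrite b1min ?zs ?eqxx // andbT.
          by apply: contra zb1 => /eqP/dist_inj->.
        by apply: contraTneq zc => ->; rewrite -leqNgt.
      have zP : s < rho z by rewrite ltn_neqAle eq_sym zs.
      by rewrite (neq_rho zP bs) pmX // (leq_trans h3).
    by rewrite cardsU1 -add1n leq_add2r leq_b1.
  apply: (@no_alternation _ p p b1 b m (window_family jN hj)) => //.
  - by apply/negP => /windowP[_]; rewrite distii.
  - apply/windowP; split; rewrite ?b1s ?dist_gt0 //; exact: ltn_trans mj.
  - by apply/negP => /windowP[_ _ _ /(_ bs)]; rewrite ltnS leqNgt b1b.
  - apply/windowP; split=> //; [exact: ltnW|exact: dist_gt0|].
    by move=> e; rewrite e ltnn in mP.
  - by rewrite distii dist_gt0.
have subW (z : 'I_N) : z \in b1 |: P1 :\ p -> z \in window rho s p 1 c N.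
  rewrite !inE => /orP[/eqP->|/andP[zp zP]]; rewrite ?b1s ?leqnn ?dist_gt0 ?dist_lt //=.
    by rewrite implybT.
  by rewrite (ltnW zP) (gtn_eqF zP).
(* The window contains [P1] with [p] traded for [b1]; having fewer than [k] elements, it forces the
   extreme case. *)
have cardP1 : #|P1|.+1 = k.
  apply/eqP; rewrite eqn_leq card_P1 andbT; apply: leq_trans Wk; rewrite ltnS.
  have -> : #|P1| = #|b1 |: P1 :\ p| by rewrite cardsU1 b1P1p /= add1n cardP1p.
  by apply/subset_leq_card/subsetP.
have b1first (z : 'I_N) : rho z = s -> z != b1 -> D p b1 < D p z.
  move=> zs zb1; rewrite ltnNge; apply/negP => zc; move: Wk; rewrite ltnNge => /negP[].
  have zn : z \notin b1 |: P1 :\ p by rewrite !inE zs ltnn andbF orbF.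
  have <- : #|z |: (b1 |: P1 :\ p)| = k.
    by rewrite !cardsU1 zn b1P1p /= !add1n cardP1p cardP1.
  apply/subset_leq_card/subsetP => y /setU1P[->|/subW //].
  apply/windowP; split; rewrite ?zs ?dist_lt ?dist_gt0 //.
  by rewrite eq_sym neq_rho.
have bn : b \notin b1 |: P1 :\ p.
  by rewrite !inE bs ltnn andbF orbF; apply: contraNneq b1X => <-.
(* [P1 :\ p] has [k - 2] elements, so this test set adds two of rank [s], among them [b1], the first
   after [p]. *)
have [||c' hI famI] := @window_fill p.
- by rewrite -cardP1 -cardP1p ltnW.
- have <- : #|b |: (b1 |: P1 :\ p)| = k.
    by rewrite !cardsU1 bn b1P1p /= !add1n cardP1p cardP1.
  apply/subset_leq_card/subsetP => y; rewrite !inE.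
  case/or3P => [/eqP->|/eqP->|/andP[-> /ltnW //]]; rewrite ?b1s ?bs ?leqnn ?b1p ?bp //.
set I := window _ _ _ _ _ _ in hI famI.
have P1I z : s < rho z -> z != p -> z \in I.
  move=> zP zp; apply/windowP; split; rewrite ?dist_gt0 ?dist_lt //.
    exact: ltnW.
  by move=> e; rewrite e ltnn in zP.
have pI : p \notin I by apply/negP => /windowP[_]; rewrite distii.
have b1I : b1 \in I.
  apply/negPn/negP => b1I; suff : k < k by rewrite ltnn.
  rewrite -{1}hI -cardP1 ltnS -cardP1p ltnW // ltnS.
  apply/subset_leq_card/subsetP => z zI; have /windowP[h1 h2 _ h4] := zI.
  rewrite !inE; apply/andP; split; first by apply: contraTneq zI => ->.
  rewrite ltn_neqAle h1 andbT; apply/eqP => /esym zs; case/negP: b1I.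
  have zb1 : D p b1 <= D p z by case: (altP (z =P b1)) => [->//|/(b1first z zs)/ltnW].
  apply/windowP; split; rewrite ?b1s ?dist_gt0 ?dist_lt // => _.
  exact: leq_ltn_trans (h4 zs).
(* Otherwise [I] would contain [X] without [p], together with [m] and [b1]: [k + 1] elements. *)
have [b2 [b2X b2s b2I]] : exists b2, [/\ b2 \in X, rho b2 = s & b2 \notin I].
  have [/exists_inP[b2 b2X /andP[/eqP ? ?]]|] :=
    boolP [exists b2 in X, (rho b2 == s) && (b2 \notin I)]; first by exists b2.
  move=> /exists_inPn H; suff : k < k by rewrite ltnn.
  have -> : k.+1 = #|b1 |: (m |: X :\ p)|.
    rewrite !cardsU1 !inE (negbTE b1X) (negbTE mX) !andbF orbF.
    by rewrite eq_sym neq_rho //= !add1n -cardX (cardsD1 p X) pX.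
  rewrite -[X in _ <= X]hI; apply/subset_leq_card/subsetP => z.
  case/setU1P => [->//|/setU1P[->|/setD1P[zp zX]]]; first exact: P1I.
  case: (altP (rho z =P s)) => [zs|zs]; last by rewrite P1I // ltn_neqAle eq_sym zs X_rank.
  by have := H z zX; rewrite zs eqxx negbK.
have b12 : D p b1 < D p b2 by apply: b1first => //; apply: contraNneq b1X => <-.
(* If [b2] comes before [m], then [p], [b1], [b2], [m] alternate for [I]; if after, [b1], [b], [m],
   [b2] alternate for [b1 |: P1]. *)
have [b2m|mb2] := ltnP (D p b2) (D p m).
  apply: (@no_alternation _ p p b1 b2 m famI) => //; first exact: P1I.
  by rewrite distii dist_gt0.
have bb1 : b \notin b1 |: P1.
  by rewrite !inE bs ltnn orbF; apply: contraNneq b1X => <-.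
have b2b1 : b2 \notin b1 |: P1.
  by rewrite !inE b2s ltnn orbF; apply: contraNneq b1X => <-.
apply: (@no_alternation_r _ p b1 b m b2 (family_setU1 b1s cardP1)) => //.
- exact: setU11.
- by rewrite !inE mP orbT.
- rewrite ltn_neqAle mb2 andbT; apply: contraNneq mX => /dist_inj->; exact: b2X.
Qed.

Lemma card_swap (v b m1 m2 : 'I_N) : v \in X -> b \in X -> v != b ->
  #|m1 |: (m2 |: X :\ v :\ b)| <= k.
Proof.
move=> vX bX vb; rewrite -cardX (cardsD1 v X) vX (cardsD1 b (X :\ v)) !inE.
rewrite eq_sym vb bX !cardsU1 /=.
by do 2![apply: leq_add; first exact: leq_b1].
Qed.

(** A member of the family containing [m1] and [m2] but neither [v] nor some [b] of rank [s] in [X]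
    gives the alternation [v], [m1], [b], [m2]. This will force the whole of [X] into the gap around
    its rank-[s] elements. *)
Lemma no_enclosed v m1 m2 (b0 : 'I_N) :
  v \in X -> s < rho v -> m1 \notin X -> s < rho m1 -> m2 \notin X -> s < rho m2 ->
  b0 \in X -> rho b0 = s ->
  (forall b, b \in X -> rho b = s -> D v m1 < D v b /\ D v b < D v m2) ->
  (forall z, s < rho z -> D v m1 < D v z -> D v z < D v m2 -> z \in X) -> False.
Proof.
move=> vX vP m1X m1P m2X m2P b0X b0s between inside.
have [mb0 b0m] := between b0 b0X b0s.
have m1v : m1 != v by apply: contraNneq m1X => ->.
have m2v : m2 != v by apply: contraNneq m2X => ->.
have m12 : m1 != m2.
  by apply: contraTneq mb0 => ->; rewrite -leqNgt ltnW.
have cardX2 : #|m1 |: (m2 |: X :\ v)| = k.+1.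
  rewrite !cardsU1 !inE (negbTE m1X) (negbTE m2X) (negbTE m12) !andbF /=.
  by rewrite !add1n -cardX (cardsD1 v X) vX.
have [kP|Pk] := leqP k #|P1 :\ v|.
  have [||||I [famI IP winI]] := @window_grow v (D v m1) (D v m2).
  - exact: dist_gt0.
  - exact: dist_lt.
  - exact: kP.
  - apply: leq_trans (@card_swap v b0 m1 m2 vX b0X (neq_rho vP b0s)).
    apply/subset_leq_card/subsetP => z; rewrite !inE => /andP[zP /andP[h1 h2]].
    case: (altP (z =P m1)) => //= zm1; case: (altP (z =P m2)) => //= zm2.
    rewrite (neq_rho zP b0s) inside ?andbT //=.
    + by apply: contraTneq h1 => ->; rewrite distii -ltnNge dist_gt0.
    + by rewrite ltn_neqAle h1 andbT; apply: contra zm1 => /eqP/dist_inj->.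
    + by rewrite ltn_neqAle h2 andbT; apply: contra zm2 => /eqP/dist_inj->.
  have m12v : D v m1 <= D v m2 by apply: leq_trans (ltnW mb0) (ltnW b0m).
  apply: (@no_alternation I v v m1 b0 m2 famI) => //.
  - by apply/negP => /(subsetP IP); rewrite !inE eqxx.
  - by apply: winI; rewrite ?leqnn.
  - by apply/negP => /(subsetP IP); rewrite !inE b0s ltnn andbF.
  - by apply: winI; rewrite ?leqnn ?andbT.
  - by rewrite distii dist_gt0.
(* The test set takes all of [P1 :\ v] and some elements of rank [s]; with all those of [X] it would
   have [k + 1] elements. *)
have [||c hI famI] := @window_fill v; first exact: ltnW.
  rewrite -ltnS -cardX2 ltnW // ltnS; apply/subset_leq_card/subsetP => z.
  rewrite !inE => /or3P[/eqP->|/eqP->|/andP[-> /X_rank //]].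
    by rewrite m1v ltnW.
  by rewrite m2v ltnW.
set I := window _ _ _ _ _ _ in hI famI.
have P1I z : s < rho z -> z != v -> z \in I.
  move=> zP zp; apply/windowP; split; rewrite ?dist_gt0 ?dist_lt //.
    exact: ltnW.
  by move=> e; rewrite e ltnn in zP.
have [b [bX bs bI]] : exists b, [/\ b \in X, rho b = s & b \notin I].
  have [/exists_inP[b bX /andP[/eqP ? ?]]|] :=
    boolP [exists b in X, (rho b == s) && (b \notin I)]; first by exists b.
  move=> /exists_inPn H; suff : k < k by rewrite ltnn.
  rewrite -cardX2 -[X in _ <= X]hI; apply/subset_leq_card/subsetP => z.
  case/setU1P => [->|/setU1P[->|/setD1P[zp zX]]]; [exact: P1I|exact: P1I|].
  case: (altP (rho z =P s)) => [zs|zs]; last by rewrite P1I // ltn_neqAle eq_sym zs X_rank.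
  by have := H z zX; rewrite zs eqxx negbK.
have [mb bm] := between b bX bs.
apply: (@no_alternation I v v m1 b m2 famI) => //; try exact: P1I.
- by apply/negP => /windowP[_]; rewrite distii.
- by rewrite distii dist_gt0.
Qed.

(** The alternation is [w], [m1], [b], [m2]. The test set is a stretch of [P1] if [k <= #|P1|], and
    otherwise [P1] with a third element of rank [s] of [X]. *)
Lemma no_split (w b : 'I_N) m1 m2 :
  w \in X -> rho w = s -> b \in X -> rho b = s ->
  m1 \notin X -> s < rho m1 -> m2 \notin X -> s < rho m2 ->
  D w m1 < D w b -> D w b < D w m2 -> False.
Proof.
move=> wX ws bX bs m1X m1P m2X m2P m1b bm2.
have wb : w != b by apply: contraTneq m1b => ->; rewrite distii.
have wP1 : w \notin P1 by rewrite inE ws ltnn.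
have [kP|Pk] := leqP k #|P1|.
  have Pm1 : [&& s < rho m1, m1 \notin X & D w m1 < D w b] by rewrite m1P m1X.
  have Pm2 : [&& s < rho m2, m2 \notin X & D w b < D w m2] by rewrite m2P m2X.
  (* [m1] and [m2] are replaced by the missing elements nearest to [b], so that everything of [P1]
     strictly between them is in [X] and the stretch has at most [k] elements. *)
  have [n1 /and3P[n1P n1X n1b] n1max] := @arg_maxnP _ m1
    (fun z => [&& s < rho z, z \notin X & D w z < D w b]) (D w) Pm1.
  have [n2 /and3P[n2P n2X bn2] n2min] := @arg_minnP _ m2
    (fun z => [&& s < rho z, z \notin X & D w b < D w z]) (D w) Pm2.
  have n1w : n1 != w by apply: contraNneq n1X => ->.
  have [||||I [famI IP winI]] := @window_grow w (D w n1) (D w n2).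
  - exact: dist_gt0.
  - exact: dist_lt.
  - by move: kP; rewrite (cardsD1 w P1) (negbTE wP1).
  - apply: leq_trans (@card_swap w b n1 n2 wX bX wb).
    apply/subset_leq_card/subsetP => z; rewrite !inE => /andP[zP /andP[h1 h2]].
    case: (altP (z =P n1)) => //= zn1; case: (altP (z =P n2)) => //= zn2.
    rewrite (neq_rho zP bs) (neq_rho zP ws) /=; apply/negPn/negP => zX.
    case: (ltngtP (D w z) (D w b)) => zb.
    + case/negP: zn1; apply/eqP/(@dist_inj _ w)/eqP; rewrite eqn_leq h1 andbT.
      by apply: n1max; rewrite zP zX.
    + case/negP: zn2; apply/eqP/(@dist_inj _ w)/eqP; rewrite eqn_leq h2.
      by apply: n2min; rewrite zP zX.
    + by move: zX; rewrite (dist_inj zb) bX.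
  have n12 : D w n1 <= D w n2 by apply: leq_trans (ltnW n1b) (ltnW bn2).
  apply: (@no_alternation I w w n1 b n2 famI) => //.
  - by apply/negP => /(subsetP IP); rewrite !inE eqxx.
  - by apply: winI; rewrite ?leqnn.
  - by apply/negP => /(subsetP IP); rewrite !inE bs ltnn andbF.
  - by apply: winI; rewrite ?leqnn ?andbT.
  - by rewrite distii dist_gt0.
have cardP1 : #|P1|.+1 = k by apply/eqP; rewrite eqn_leq card_P1 andbT.
have m12 : m2 != m1 by apply: contraTneq m1b => <-; rewrite -leqNgt ltnW.
(* Without a third one, [X] would lie in [P1] with [m1] and [m2] traded for [w] and [b], which has
   [k - 1] elements. *)
have [b2 [b2X b2s b2w b2b]] :
    exists b2, [/\ b2 \in X, rho b2 = s, b2 != w & b2 != b].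
  have [/exists_inP[b2 b2X /and3P[/eqP ? ? ?]]|] :=
    boolP [exists b2 in X, [&& rho b2 == s, b2 != w & b2 != b]]; first by exists b2.
  move=> /exists_inPn H; suff : k < k by rewrite ltnn.
  rewrite -{2}cardP1 ltnS (cardsD1 m1 P1) inE m1P (cardsD1 m2 (P1 :\ m1)) !inE m12 m2P.
  apply: (@leq_trans #|w |: (b |: (P1 :\ m1) :\ m2)|); last first.
    by rewrite !cardsU1; do 2![apply: leq_add; first exact: leq_b1].
  rewrite -cardX; apply/subset_leq_card/subsetP => z zX; rewrite !inE.
  have := H z zX; rewrite ltn_neqAle X_rank // andbT [s == _]eq_sym.
  have -> : z != m1 by apply: contraNneq m1X => <-.
  have -> : z != m2 by apply: contraNneq m2X => <-.
  by case: (rho z == s) => //=; case: (z == w) => //=; case: (z == b).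
apply: (@no_alternation _ w w m1 b m2 (family_setU1 b2s cardP1)) => //.
- by rewrite !inE ws ltnn orbF eq_sym.
- by rewrite !inE m1P orbT.
- by rewrite !inE bs ltnn orbF eq_sym.
- by rewrite !inE m2P orbT.
- by rewrite distii dist_gt0 //; apply: contraNneq m1X => ->.
Qed.

Lemma noncrossing_arc_family (b0 : 'I_N) :
  b0 \in X -> rho b0 = s -> arc_family rho k s0 X.
Proof.
move=> b0X b0s.
have [/existsP[m /andP[mP mX]]|] := boolP [exists m, (s < rho m) && (m \notin X)];
  last first.
  move=> /existsPn P1X; have b0P1 : b0 \notin P1 by rewrite inE b0s ltnn.
  have sub : b0 |: P1 \subset X.
    apply/subsetP => z; rewrite !inE => /orP[/eqP->//|zP].
    by have := P1X z; rewrite zP negbK.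
  have cU : #|b0 |: P1| = #|P1|.+1 by rewrite cardsU1 b0P1.
  have XE : b0 |: P1 = X by apply/eqP; rewrite eqEcard sub cardX cU.
  by rewrite -XE; apply: family_setU1; rewrite // -cU XE.
(* Seen from [b0], [m1] is the last and [m2] the first missing element: the two ends of the gap
   around [b0]. *)
have [m1 /andP[m1P m1X] m1max] :=
  @arg_maxnP _ m (fun z => (s < rho z) && (z \notin X)) (D b0) (introT andP (conj mP mX)).
have [m2 /andP[m2P m2X] m2min] :=
  @arg_minnP _ m (fun z => (s < rho z) && (z \notin X)) (D b0) (introT andP (conj mP mX)).
have m21 : D b0 m2 <= D b0 m1 by apply: m1max; rewrite m2P m2X.
have in1 z : s < rho z -> z \notin X -> D b0 m2 <= D b0 z <= D b0 m1.
  by move=> zP zX; apply/andP; split; [apply: m2min|apply: m1max]; rewrite zP zX.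
have m2gt0 : 0 < D b0 m2 by apply: dist_gt0; apply: contraNneq m2X => ->.
have neqD z y : z \in X -> y \notin X -> D b0 z <> D b0 y.
  by move=> zX yX /dist_inj e; rewrite e (negbTE yX) in zX.
have outB b : b \in X -> rho b = s -> D b0 b < D b0 m2 \/ D b0 m1 < D b0 b.
  move=> bX bs; case: (ltngtP (D b0 b) (D b0 m2)) => [|h2|/(neqD _ _ bX m2X)//]; first by left.
  case: (ltngtP (D b0 b) (D b0 m1)) => [h1||/(neqD _ _ bX m1X)//]; last by right.
  by exfalso; apply: (@no_split b0 b m2 m1).
have out z : z \in X -> D b0 z < D b0 m2 \/ D b0 m1 < D b0 z.
  move=> zX; case: (altP (rho z =P s)) => [zs|zs]; first exact: outB.
  have zP : s < rho z by rewrite ltn_neqAle eq_sym zs X_rank.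
  case: (ltngtP (D b0 z) (D b0 m2)) => [|h2|/(neqD _ _ zX m2X)//]; first by left.
  case: (ltngtP (D b0 z) (D b0 m1)) => [h1||/(neqD _ _ zX m1X)//]; last by right.
  exfalso; apply: (@no_enclosed z m1 m2 b0) => //.
    move=> b bX bs; move: (outB b bX bs) h1 h2.
    move: (dist_shift b0 z b) (dist_shift b0 z m1) (dist_shift b0 z m2).
    move: (dist_lt z b) (dist_lt z m1) (dist_lt z m2) (dist_lt b0 m1) (dist_lt b0 b).
    by clear; lia.
  move=> y yP h3 h4; apply/negPn/negP => /(in1 y yP)/andP[h5 h6]; move: h1 h2 h3 h4 h5 h6.
  move: (dist_shift b0 z y) (dist_shift b0 z m1) (dist_shift b0 z m2).
  move: (dist_lt z y) (dist_lt z m1) (dist_lt z m2) (dist_lt b0 m1).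
  by clear; lia.
(* Length of the gap from [m1] through [b0] to [m2]. If [m1 = m2] is the only missing element, the
   gap is a full turn, whereas [D m1 m2] is 0. *)
pose H := if m1 == m2 then N else D m1 m2.
have HN : H <= N by rewrite /H; case: ifP => // _; apply/ltnW/dist_lt.
have HE : D b0 m1 + H = D b0 m2 + N.
  rewrite /H; case: (altP (m1 =P m2)) => [->//|m12].
  have : D b0 m1 <> D b0 m2 by move=> /dist_inj e; rewrite e eqxx in m12.
  move: (dist_shift b0 m1 m2) m21 (dist_lt m1 m2); clear; lia.
have inX z : z \in X -> 0 < D m1 z /\ D m1 z < H.
  move=> zX; move: (out z zX) HE m21 m2gt0 (dist_shift b0 m1 z).
  by move: (dist_lt b0 m1) (dist_lt b0 z) (dist_lt m1 z); clear; lia.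
have Xin z : s < rho z -> 0 < D m1 z -> D m1 z < H -> z \in X.
  move=> zP h1 h2; apply/negPn/negP => /(in1 z zP)/andP[h5 h6].
  move: h1 h2 h5 h6 HE m21 m2gt0 (dist_shift b0 m1 z) HN.
  by move: (dist_lt b0 m1) (dist_lt b0 z) (dist_lt m1 z); clear; lia.
(* The first element [i] of [X] and its last element [bl] of rank [s], seen from [m1], determine the
   window that [X] must be. *)
have [i iX imin] := @arg_minnP _ b0 (fun z => z \in X) (D m1) b0X.
have PB : (b0 \in X) && (rho b0 == s) by rewrite b0X b0s eqxx.
have [bl /andP[blX /eqP bls] blmax] :=
  @arg_maxnP _ b0 (fun z => (z \in X) && (rho z == s)) (D m1) PB.
suff XE : X = window rho s m1 (D m1 i) (D m1 bl).+1 H.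
  by rewrite XE; apply: window_family; rewrite // -XE.
apply/setP => z; apply/idP/windowP => [zX|[h1 h2 h3 h4]].
  split; [exact: X_rank|exact: imin|by have [] := inX z zX|move=> zs].
  by rewrite ltnS; apply: blmax; rewrite zX zs eqxx.
have [i0 iH] := inX i iX.
case: (altP (rho z =P s)) => [zs|zs]; last first.
  by apply: Xin => //; [rewrite ltn_neqAle eq_sym zs|apply: leq_trans h2].
apply/negPn/negP => zX.
have iz : D m1 i < D m1 z.
  rewrite ltn_neqAle h2 andbT; apply/eqP => /dist_inj e.
  by rewrite -e iX in zX.
have zbl : D m1 z < D m1 bl.
  rewrite ltn_neqAle -ltnS h4 // andbT; apply/eqP => /dist_inj e.
  by rewrite e blX in zX.
(* [no_gap_below] needs an element of [P1] before [z]: either [i], or one of the rank of [m1]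
   interleaved between [i] and [z], which is in [X] because it lies in the gap. *)
have [p [pX pP pz]] : exists p, [/\ p \in X, s < rho p & D m1 p < D m1 z].
  case: (altP (rho i =P s)) => [is_|is_]; last first.
    by exists i; split=> //; rewrite ltn_neqAle eq_sym is_ X_rank.
  have m1i : rho m1 <> rho i by move=> e; rewrite e is_ ltnn in m1P.
  have [p [p1 p2 p3]] := interleave (etrans is_ (esym zs)) m1i iz.
  exists p; split; rewrite ?p1 //; apply: Xin; rewrite ?p1 //.
    exact: leq_trans i0 (ltnW p2).
  exact: ltn_trans p3 h3.
have [p0 pH] := inX p pX; have [_ blH] := inX bl blX.
have pm2 : D m1 p + D p m2 = H.
  move: (dist_shift m1 p m2) pH p0 (dist_lt p m2); rewrite /H.
  case: (altP (m1 =P m2)) => [<-|m12]; rewrite ?distii; clear; lia.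
apply: (@no_gap_below p m2 z bl) => //.
- move=> y yP yp; move: (dist_shift m1 p y) (dist_lt m1 y) => yE yN.
  by apply: Xin => //; move: yE yN yp pm2 p0 HN; clear; lia.
- move: (dist_shift m1 p z) (dist_shift m1 p bl) pz zbl (dist_lt p z) (dist_lt p bl).
  by clear; lia.
- move: (dist_shift m1 p bl) pm2 pz zbl blH (dist_lt p bl).
  by clear; lia.
Qed.

End NonCrossing.
End Maximal.

(** * Ranks of residue classes *)

Lemma dist_mod N k (i z : 'I_N) : k %| N -> dist N i z + i = z %[mod k].
Proof.
move=> kN; case: (distE N i z) => -[h ->]; first by rewrite subnK.
rewrite subnK; first by rewrite -modnDmr (eqP kN) addn0.
by rewrite (leq_trans (ltnW (ltn_ord i))) ?leq_addl.
Qed.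

Section Rank.

Variables (d k : nat) (a : 'I_k -> 'I_(d * k)).
Hypothesis a_inj : injective a.
Hypothesis a_img : [set a i | i : 'I_k] = [set x : 'I_(d * k) | (x < k)%N].

Local Notation N := (d * k).
Implicit Types (x y z w : 'I_N) (s : 'I_k).

(* [P_s] is the set of [z] with [s <= rank z]; the default 0 is never taken. *)
Definition rank z : nat :=
  if [pick s : 'I_k | a s == z %% k :> nat] is Some s then nat_of_ord s else 0.

Lemma ltak s : a s < k.
Proof.
have : a s \in [set a i | i : 'I_k] by apply: imset_f.
by rewrite a_img inE.
Qed.

Lemma k_gt0 z : 0 < k.
Proof.
have : 0 < N := leq_ltn_trans (leq0n z) (ltn_ord z).
by rewrite muln_gt0 => /andP[].
Qed.

Lemma rankP z : exists2 s : 'I_k, rank z = s & a s = z %% k :> nat.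
Proof.
rewrite /rank; case: pickP => [s /eqP h|h]; first by exists s.
have zN : z %% k < N := leq_ltn_trans (leq_mod z k) (ltn_ord z).
have : Ordinal zN \in [set a i | i : 'I_k].
  by rewrite a_img inE /= ltn_pmod // (k_gt0 z).
by case/imsetP => s _ /(congr1 val) /= e; have := h s; rewrite -e eqxx.
Qed.

Lemma rank_lt z : rank z < k.
Proof. by have [s -> _] := rankP z. Qed.

Lemma rankE x y : (rank x == rank y) = (x == y %[mod k]).
Proof.
have [s -> <-] := rankP x; have [t -> <-] := rankP y.
apply/eqP/eqP => [/ord_inj->//|/ord_inj/a_inj->//].
Qed.

Lemma rank_mod x y : x = y %[mod k] -> rank x = rank y.
Proof. by move=> /eqP; rewrite -rankE => /eqP. Qed.

Lemma rank_a s : rank (a s) = s.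
Proof.
have [t -> h] := rankP (a s); congr nat_of_ord; apply: a_inj; apply: ord_inj.
by rewrite h modn_small // ltak.
Qed.

Lemma bar_rank s z : (z \in bar (a s)) = (rank z == s).
Proof. by rewrite inE -(rank_a s) rankE. Qed.

Lemma card_rank s : #|[set z | rank z == s]| = d.
Proof.
have h (m : 'I_d) : a s + m * k < N.
  apply: (@leq_trans (m.+1 * k)); first by rewrite mulSn ltn_add2r ltak.
  by rewrite leq_mul2r ltn_ord orbT.
have k0 : 0 < k := k_gt0 (a s).
have E : #|[set Ordinal (h m) | m : 'I_d]| = d.
  rewrite card_imset ?card_ord // => m m' /(congr1 val) /= /addnI /eqP.
  by rewrite eqn_pmul2r // => /eqP /ord_inj.
rewrite -[RHS]E; apply: eq_card => z; rewrite inE -bar_rank inE; apply/eqP/imsetP => [e|[m _ ->]].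
  have zd : z %/ k < d by rewrite ltn_divLR.
  exists (Ordinal zd) => //; apply: ord_inj => /=.
  by rewrite [LHS](divn_eq z k) e modn_small ?ltak // addnC.
by rewrite /= addnC modnMDl.
Qed.

Lemma card_rank_ge t : t <= k -> #|[set z | t <= rank z]| = d * (k - t).
Proof.
move=> tk; rewrite -{1}(subKn tk); move: (k - t) (leq_subr t k) => u {t tk}.
elim: u => [|u IHu] uk.
  rewrite subn0 muln0; apply/eqP; rewrite cards_eq0; apply/eqP/setP => z.
  by rewrite !inE leqNgt rank_lt.
have sk : k - u.+1 < k by lia.
rewrite mulnS -(IHu (ltnW uk)) -[X in _ = X + _](card_rank (Ordinal sk)) -cardsUI /=.
rewrite [X in _ = _ + X]eq_card0 ?addn0.
  apply: eq_card => z; rewrite !inE leq_eqVlt eq_sym.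
  by rewrite subnSK.
move=> z; rewrite !inE; apply/negbTE/negP => /andP[/eqP->].
by rewrite leqNgt; move: uk; clear; lia.
Qed.

Lemma rank_interleave w x y z : rank x = rank y -> rank z <> rank x ->
  dist N w x < dist N w y ->
  exists z', [/\ rank z' = rank z, dist N w x < dist N w z'
                & dist N w z' < dist N w y].
Proof.
move=> /eqP; rewrite rankE => /eqP exy /eqP; rewrite rankE => nzx xy.
have k0 := k_gt0 x; have kN : k %| N by apply: dvdn_mull.
have Dxy : dist N w x + dist N x y = dist N w y.
  by move: (dist_shift w x y) xy (dist_lt x y) (dist_lt w y); clear; lia.
have kD : k <= dist N x y.
  apply: dvdn_leq; first by lia.
  by rewrite /dvdn -(mod0n k) -/(_ == _ %[mod k]) -(eqn_modDr x) (dist_mod x y kN) add0n exy.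
(* The residue of [z - x] modulo [k], so that [t] steps after [x] comes the class of [z], within the
   distance of at least [k] from [x] to [y]. *)
pose t := (z %% k + (k - x %% k)) %% k.
have tk : t < k by rewrite ltn_pmod.
have tx : t + x = z %[mod k].
  rewrite /t modnDml -modnDmr -addnA subnK; last by rewrite ltnW // ltn_pmod.
  by rewrite modnDr modn_mod.
have t0 : 0 < t.
  by rewrite lt0n; apply: contraNneq nzx => t0; rewrite -tx t0.
have [z' z'E] : exists z', dist N x z' = t.
  by apply/exists_dist/(leq_ltn_trans (leq_trans (ltnW tk) kD))/dist_lt.
exists z'; split.
- by apply: rank_mod; rewrite -(dist_mod x z' kN) z'E.
- move: (dist_shift w x z') (dist_lt w y) t0 (leq_trans tk kD) Dxy; rewrite z'E.
  by move: (t); clear; lia.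
- move: (dist_shift w x z') (dist_lt w y) t0 (leq_trans tk kD) Dxy; rewrite z'E.
  by move: (t); clear; lia.
Qed.

End Rank.

Lemma arc_family_maximal (d k s0 : nat) (a : 'I_k -> 'I_(d * k)) (p c : int)
    (X : {set 'I_(d * k)}) :
  injective a -> [set a i | i : 'I_k] = [set x : 'I_(d * k) | (x < k)%N] ->
  (k%:Z = d%:Z * p + c)%R -> (c = -1 \/ c = 0 \/ c = 1)%R ->
  (d = 1 -> c = 0%R) -> 0 < k ->
  #|X| = k -> (forall z, z \in X -> s0 <= rank a z) ->
  (forall I, arc_family (rank a) k s0 I -> ~~ crossing X I) ->
  arc_family (rank a) k s0 X.
Proof.
move=> a_inj a_img kE cE d1 k0 cardX Xs0 noX.
have /card_gt0P[x xX] : 0 < #|X| by rewrite cardX.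
have [b bX bmin] := @arg_minnP _ x (fun z => z \in X) (rank a) xX.
have s0b := Xs0 b bX; have bk := rank_lt a_img b.
have XP0 : X \subset [set z | rank a b <= rank a z].
  by apply/subsetP => z zX; rewrite inE; apply: bmin.
have cP0 := card_rank_ge a_inj a_img (ltnW bk).
have cP1 := card_rank_ge a_inj a_img bk.
have [h|h] := leqP k #|[set z | rank a b < rank a z]|.+1.
  exact: (noncrossing_arc_family s0b (rank_interleave a_inj a_img) cardX XP0 h
    noX bX erefl).
apply: (@codim1_family _ _ _ _ (rank a b)) => //.
  by apply/set0Pn; exists x.
rewrite cP0; rewrite cP1 in h; have := subset_leq_card XP0; rewrite cardX cP0.
have -> : k - rank a b = (k - (rank a b).+1).+1 by lia.
move: h; move: (k - (rank a b).+1) => q h hq; move: kE cE d1 h hq; clear.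
(* P_(s+1) and P_s have [d * q] and [d * (q + 1)] elements. From [d q + 1 < k <= d q + d] and
   [k = d p + c] follows [r = 0], that is [k = d (q + 1) + c], and [c >= -1] gives the bound. *)
have [r ->] : exists r, p = (r + q%:Z + 1)%R by exists (p - q%:Z - 1)%R; lia.
move=> kE cE d1 h hq.
have {}h : (d%:Z * q%:Z + 1 < k%:Z)%R by lia.
have {}hq : (k%:Z <= d%:Z * q%:Z + d%:Z)%R by lia.
suff : (d%:Z * q%:Z + d%:Z <= k%:Z + 1)%R by lia.
have dE : (d%:Z * (r + q%:Z + 1) = d%:Z * r + d%:Z * q%:Z + d%:Z)%R.
  by rewrite !GRing.mulrDr GRing.mulr1.
rewrite {}dE in kE; move: kE h hq; move: (d%:Z * q%:Z)%R => y kE h hq.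
have [r0|r0] : (r <= -1)%R \/ (0 <= r)%R by lia.
  have : (d%:Z * r <= - d%:Z)%R by nia.
  by lia.
have [r1|r1] : (r = 0)%R \/ (1 <= r)%R by lia.
  by rewrite r1 GRing.mulr0 in kE; lia.
have : (d%:Z <= d%:Z * r)%R by nia.
by lia.
Qed.

(** * Induced successors *)

Section Successor.

Variable N : nat.
Implicit Types (q x y z i u : 'I_N) (Q : {set 'I_N}).
Local Notation D := (dist N).

Lemma dist_oplus x t : t < N -> D x (oplus x t) = t.
Proof.
move=> tN; have xN := ltn_ord x; rewrite /dist /=.
have [h|h] := ltnP (x + t) N; first by rewrite modn_small // leq_addr addKn.
have -> : (x + t) %% N = x + t - N.
  by rewrite -[in LHS](subnK h) modnDr modn_small //; move: xN tN h; clear; lia.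
by rewrite leqNgt (_ : x + t - N < x) /=; move: xN tN h; clear; lia.
Qed.

Lemma oplus_dist x z : oplus x (D x z) = z.
Proof. by apply: (@dist_inj _ x); rewrite dist_oplus ?dist_lt. Qed.

Lemma oplusA x t r : oplus (oplus x t) r = oplus x (t + r).
Proof. by apply: ord_inj; rewrite /= modnDml addnA. Qed.

Lemma oplus_mod x t r : t = r %[mod N] -> oplus x t = oplus x r.
Proof. by move=> tr; apply: ord_inj; rewrite /= -modnDmr tr modnDmr. Qed.

Lemma oplus0 x : oplus x 0 = x.
Proof. by apply: ord_inj; rewrite /= addn0 modn_small. Qed.

Lemma oplusN x : oplus x N = x.
Proof. by rewrite -[RHS]oplus0; apply: oplus_mod; rewrite modnn mod0n. Qed.

Lemma iter_ordS j x : iter j (@ordS N) x = oplus x j.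
Proof.
elim: j => [|j IHj]; first by rewrite oplus0.
by rewrite iterS IHj; apply: ord_inj; rewrite /= -addn1 modnDml -addnA addn1.
Qed.

Lemma succ_inP Q q : q \in Q ->
  succ_in Q q \in Q /\
  forall z, z \in Q -> z != q -> succ_in Q q != q /\ D q (succ_in Q q) <= D q z.
Proof.
move=> qQ; have N0 : 0 < N := leq_ltn_trans (leq0n q) (ltn_ord q).
have nthE j : j < N -> nth q (traject (@ordS N) (ordS q) N) j = oplus q j.+1.
  move=> jN; rewrite (set_nth_default (ordS q)) ?size_traject // nth_traject //.
  by rewrite -iterSr iter_ordS.
have hasQ : has (mem Q) (traject (@ordS N) (ordS q) N).
  apply/(has_nthP q); exists N.-1; first by rewrite size_traject ltn_predL.
  by rewrite nthE ?ltn_predL // prednK // oplusN.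
have headE : forall s : seq 'I_N,
    head q [seq x <- s | x \in Q] = nth q s (find (mem Q) s).
  by elim=> //= x s IHs; case: ifP.
rewrite /succ_in headE; set t := traject _ _ _ in nthE hasQ *.
have jN : find (mem Q) t < N by move: hasQ; rewrite has_find size_traject.
split; first exact: (nth_find q hasQ).
move=> z zQ zq; have Dz0 := dist_gt0 zq; have DzN := dist_lt q z.
have jz : find (mem Q) t < D q z.
  rewrite -(prednK Dz0) ltnS leqNgt; apply/negP => /(before_find q) /=.
  by rewrite nthE ?(leq_ltn_trans (leq_pred _) DzN) // prednK // oplus_dist zQ.
have jN' := leq_ltn_trans jz DzN.
rewrite nthE // dist_oplus //; split=> //.
apply: contraTneq (ltn0Sn (find (mem Q) t)) => e.
by rewrite -(dist_oplus q jN') e distii.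
Qed.

(** The element [z0] beyond [y] guarantees that the successor of [y] does not wrap past the cut
    [i]. *)
Lemma succ_in_step Q i y z0 : y \in Q -> z0 \in Q -> D i y < D i z0 ->
  D i y < D i (succ_in Q y) /\
  forall z, z \in Q -> D i y < D i z -> D i (succ_in Q y) <= D i z.
Proof.
move=> yQ z0Q yz0; have [_ H] := succ_inP yQ.
have Dsh z : D i y < D i z -> D i y + D y z = D i z.
  by move: (dist_shift i y z) (dist_lt y z) (dist_lt i z); clear; lia.
have neq z : D i y < D i z -> z != y.
  by apply: contraTneq => ->; rewrite ltnn.
have [sy ys] := H z0 z0Q (neq z0 yz0); have sy0 := dist_gt0 sy.
have Ds : D i y + D y (succ_in Q y) = D i (succ_in Q y).
  move: (dist_shift i y (succ_in Q y)) (Dsh z0 yz0) ys (dist_lt i z0).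
  by clear; lia.
split=> [|z zQ yz]; first by rewrite -Ds -{1}[D i y]addn0 ltn_add2l.
have [_ h] := H z zQ (neq z yz).
by rewrite -Ds -(Dsh z yz) leq_add2l.
Qed.

Lemma iter_succ_in Q i m : i \in Q -> m < #|Q| ->
  [/\ iter m (succ_in Q) i \in Q,
      [set z in Q | D i z < D i (iter m (succ_in Q) i)]
        = [set x in traject (succ_in Q) i m] &
      #|[set x in traject (succ_in Q) i m]| = m].
Proof.
move=> iQ; elim: m => [|m IHm] mQ.
  split=> //=; last by apply: eq_card0 => z; rewrite inE.
  by apply/setP => z; rewrite !inE distii ltn0 andbF.
have [yQ yE yc] := IHm (ltnW mQ); set y := iter m (succ_in Q) i in yQ yE *.
have tE : [set x in traject (succ_in Q) i m.+1]
    = y |: [set x in traject (succ_in Q) i m].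
  by apply/setP => z; rewrite trajectSr !inE mem_rcons inE.
have yn : y \notin [set x in traject (succ_in Q) i m] by rewrite -yE inE ltnn andbF.
have cE : #|[set x in traject (succ_in Q) i m.+1]| = m.+1.
  by rewrite tE cardsU1 yn yc add1n.
have [z0 z0Q yz0] : exists2 z0, z0 \in Q & D i y < D i z0.
  have [/exists_inP[z0 ? ?]|/exists_inPn H] :=
    boolP [exists z0 in Q, D i y < D i z0]; first by exists z0.
  suff : #|Q| <= m.+1 by rewrite leqNgt mQ.
  rewrite -cE tE -yE; apply/subset_leq_card/subsetP => z zQ; rewrite !inE zQ /=.
  by have := H z zQ; rewrite -leqNgt leq_eqVlt => /orP[/eqP/dist_inj->|->];
    rewrite ?eqxx ?orbT.
have [ys smin] := succ_in_step yQ z0Q yz0; have [sQ _] := succ_inP yQ.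
split=> //=; rewrite -/y; rewrite tE -yE.
apply/setP => z; rewrite !inE; apply/andP/orP => [[zQ zs]|[/eqP->//|/andP[zQ zy]]].
- have : D i z <= D i y by rewrite leqNgt; apply/negP => /(smin z zQ); rewrite leqNgt zs.
  rewrite leq_eqVlt zQ => /orP[/eqP/dist_inj->|->]; rewrite ?eqxx ?orbT;
    by [left|right].
- by split=> //; apply: ltn_trans ys.
Qed.

Lemma traject_succ_in Q i k : i \in Q -> k <= #|Q| ->
  #|[set x in traject (succ_in Q) i k]| = k /\
  exists l, [set x in traject (succ_in Q) i k] = [set z in Q | D i z < l].
Proof.
move=> iQ; case: k => [|k] kQ.
  split; first by apply: eq_card0 => z; rewrite inE.
  by exists 0; apply/setP => z; rewrite !inE andbF.
have [yQ yE yc] := iter_succ_in iQ kQ; set y := iter k (succ_in Q) i in yQ yE *.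
have tE : [set x in traject (succ_in Q) i k.+1]
    = y |: [set x in traject (succ_in Q) i k].
  by apply/setP => z; rewrite trajectSr !inE mem_rcons inE.
rewrite tE cardsU1 yc -yE inE ltnn andbF; split=> //; exists (D i y).+1.
apply/setP => z; rewrite !inE ltnS [D i z <= _]leq_eqVlt.
apply/orP/andP => [[/eqP->|/andP[-> ->]]|[zQ /orP[/eqP/dist_inj->|zy]]].
- by rewrite yQ eqxx.
- by rewrite orbT.
- by left.
- by right; rewrite zQ.
Qed.

Lemma mem_traject_succ_in Q i k x :
  i \in Q -> x \in traject (succ_in Q) i k -> x \in Q.
Proof.
move=> iQ; elim: k i iQ => //= k IHk i iQ; rewrite inE => /orP[/eqP->//|].
by apply: IHk; have [] := succ_inP iQ.
Qed.

(** The arc is one of the closed sets being intersected. Conversely, any closed set contains the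
    iterated successors of [u] up to [v], and [z] is the iterate whose exponent counts the elements
    of [Q] before it. *)
Lemma cintervalE Q u v : u \in Q -> v \in Q ->
  cinterval Q u v = [set z in Q | D u z <= D u v].
Proof.
move=> uQ vQ; apply/eqP; rewrite eqEsubset; apply/andP; split.
  apply: bigcap_inf; apply/and4P; split.
  - by apply/subsetP => z; rewrite inE => /andP[].
  - by rewrite inE uQ distii.
  - by rewrite inE vQ leqnn.
  apply/subsetP => y /imsetP[z]; rewrite !inE => /and3P[zv zQ zle] ->.
  have zltv : D u z < D u v.
    by rewrite ltn_neqAle zle andbT; apply: contra zv => /eqP/dist_inj->.
  have [_ H] := succ_in_step zQ vQ zltv.
  by have [-> _] := succ_inP zQ; rewrite H.
apply/subsetP => z; rewrite inE => /andP[zQ zv].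
apply/bigcapP => J /and4P[JQ uJ vJ /subsetP JS].
pose L y := [set w in Q | D u w < D u y].
have LQ y : y \in Q -> #|L y| < #|Q|.
  move=> yQ; apply/proper_card/properP; split.
    by apply/subsetP => w; rewrite inE => /andP[].
  by exists y; rewrite // inE ltnn andbF.
have Lmono y y' : y \in Q -> D u y < D u y' -> #|L y| < #|L y'|.
  move=> yQ yy'; apply/proper_card/properP; split.
    by apply/subsetP => w; rewrite !inE => /andP[-> /ltn_trans->].
  by exists y; rewrite !inE yQ ?ltnn.
have iterJ m : m < #|Q| -> D u (iter m (succ_in Q) u) <= D u v ->
    iter m (succ_in Q) u \in J.
  elim: m => [//|m IHm] mQ smv.
  have [yQ yE yc] := iter_succ_in uQ (ltnW mQ).
  have [sQ sE sc] := iter_succ_in uQ mQ.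
  have ys : D u (iter m (succ_in Q) u) < D u (iter m.+1 (succ_in Q) u).
    rewrite ltnNge leq_eqVlt; apply/negP => /orP[/eqP e|/(Lmono _ _ sQ)].
      by move: sc yc; rewrite -sE -yE e => -> /esym/n_Sn.
    by rewrite /L sE yE sc yc ltnNge leqnSn.
  apply: JS; apply/imsetP; exists (iter m (succ_in Q) u) => //.
  rewrite !inE IHm ?(ltnW mQ) ?(leq_trans (ltnW ys)) // andbT.
  by apply: contraTneq ys => ->; rewrite -leqNgt.
have [yQ yE yc] := iter_succ_in uQ (LQ z zQ).
suff zE : iter #|L z| (succ_in Q) u = z.
  by rewrite -zE; apply: iterJ; rewrite ?LQ ?zE.
apply: (@dist_inj _ u); rewrite -yE -/(L _) in yc.
case: (ltngtP (D u (iter #|L z| (succ_in Q) u)) (D u z)) => // /Lmono.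
  by rewrite yQ yc ltnn => /(_ isT).
by rewrite zQ yc ltnn => /(_ isT).
Qed.

End Successor.

(** * The construction as an arc family *)

Section Rotation.

Variable N : nat.
Implicit Types (x y z i : 'I_N) (J : {set 'I_N}).

Lemma dist_oplus2 i y t : dist N (oplus i t) (oplus y t) = dist N i y.
Proof.
rewrite -{1}(oplus_dist i y) oplusA addnC -oplusA dist_oplus //.
exact: dist_lt.
Qed.

Lemma in_oplus_set J t r z : (t + r) %% N = 0 ->
  (z \in oplus_set J t) = (oplus z r \in J).
Proof.
move=> tr; apply/imsetP/idP => [[y yJ ->]|zJ].
  by rewrite oplusA (@oplus_mod _ _ _ 0) ?oplus0 // tr mod0n.
by exists (oplus z r); rewrite // oplusA addnC (@oplus_mod _ _ _ 0) ?oplus0 // tr mod0n.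
Qed.

Lemma card_oplus_set J t : #|oplus_set J t| = #|J|.
Proof.
apply: card_imset => x y e; apply: (@dist_inj _ x).
by rewrite -(dist_oplus2 x y t) -e !distii.
Qed.

End Rotation.

Section Bridge.

Variables (d k : nat) (a : 'I_k -> 'I_(d * k)).
Hypothesis a_inj : injective a.
Hypothesis a_img : [set a i | i : 'I_k] = [set x : 'I_(d * k) | (x < k)%N].

Local Notation N := (d * k).
Local Notation D := (dist N).
Local Notation rank := (rank a).
Implicit Types (x y z w i : 'I_N) (s : 'I_k).

Lemma dvd_dist x y : rank x = rank y -> k %| D x y.
Proof.
move=> /eqP; rewrite (rankE a_inj a_img) => /eqP exy.
rewrite /dvdn -(mod0n k) -/(_ == _ %[mod k]) -(eqn_modDr x).
by rewrite (dist_mod x y (dvdn_mull d (dvdnn k))) add0n exy.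
Qed.

Lemma rank_oplus z t : rank (oplus z (t * k)) = rank z.
Proof.
apply: (rank_mod a_inj a_img).
by rewrite /= modn_dvdm ?dvdn_mull // addnC modnMDl.
Qed.

Lemma dist_le_sub x y : k %| D x y -> D x y + k <= N.
Proof.
move=> /dvdnP[m e]; have := dist_lt x y; rewrite e.
have k0 : 0 < k := k_gt0 x.
by rewrite ltn_mul2r k0 /= -mulSnr leq_mul2r => ->; rewrite orbT.
Qed.

(** Distances within a class are multiples of [k], hence at most [N - k]; starting less than [k]
    before [x] leaves no room to wrap. *)
Lemma dist_split i x z : D i x < k -> rank z = rank x -> D i z = D i x + D x z.
Proof.
move=> ix zx; have := dist_le_sub (dvd_dist (esym zx)).
by move: (dist_shift i x z) (dist_lt i z) ix; clear; lia.
Qed.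

Lemma arcset_oplus (s : nat) i l1 l2 t :
  oplus_set (arcset rank s i l1 l2) (t * k) = arcset rank s (oplus i (t * k)) l1 l2.
Proof.
apply/setP => z; have N0 : 0 < N := leq_ltn_trans (leq0n z) (ltn_ord z).
(* [N.-1 * t * k] is the inverse rotation, written as a multiple of [k] so that it preserves
   ranks. *)
have e : (t * k + N.-1 * t * k) %% N = 0.
  rewrite -mulnA -{1}[t * k]mul1n -mulnDl add1n prednK //; exact: modnMr.
rewrite (in_oplus_set _ _ e) !in_arcset rank_oplus.
suff -> : D i (oplus z (N.-1 * t * k)) = D (oplus i (t * k)) z by [].
rewrite -(dist_oplus2 i _ (t * k)) oplusA (@oplus_mod _ z _ 0) ?oplus0 //.
by rewrite addnC e mod0n.
Qed.

Lemma Pset_rank s : Pset a s = [set z | s <= rank z].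
Proof.
apply/setP => z; rewrite !inE leqNgt; congr (~~ _).
apply/bigcupP/idP => [[i is_]|zs].
  by rewrite (bar_rank a_inj a_img) => /eqP->.
exists (Ordinal (rank_lt a_img z)) => //.
by rewrite (bar_rank a_inj a_img) eqxx.
Qed.

Lemma succ_in_bar s y : y \in bar (a s) -> succ_in (bar (a s)) y = oplus y (1 * k).
Proof.
move=> yb; have [sb H] := succ_inP yb; have k0 : 0 < k := k_gt0 y.
have rb z : z \in bar (a s) -> rank z = s by rewrite (bar_rank a_inj a_img) => /eqP.
have oyb : oplus y (1 * k) \in bar (a s).
  by rewrite (bar_rank a_inj a_img) rank_oplus (rb _ yb).
have [e|oy] := eqVneq (oplus y (1 * k)) y.
  rewrite e; apply/eqP/negPn/negP => sy.
  have kD : k <= D y (succ_in (bar (a s)) y).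
    by rewrite dvdn_leq ?dist_gt0 // dvd_dist // !rb.
  have kN : 1 * k < N by rewrite mul1n; apply: leq_ltn_trans kD (dist_lt _ _).
  by have := dist_oplus y kN; rewrite e distii mul1n => /eqP; rewrite (ltn_eqF k0).
have [sy sle] := H _ oyb oy.
have kD z : z \in bar (a s) -> z != y -> k <= D y z.
  by move=> zb zy; rewrite dvdn_leq ?dist_gt0 // dvd_dist // !rb.
have kN : 1 * k < N.
  by rewrite mul1n; apply: leq_ltn_trans (kD _ oyb oy) (dist_lt _ _).
apply: (@dist_inj _ y); apply/eqP; rewrite eqn_leq sle.
by rewrite (dist_oplus y kN) mul1n kD.
Qed.

Lemma iter_succ_in_bar s m :
  iter m (succ_in (bar (a s))) (a s) = oplus (a s) (m * k).
Proof.
elim: m => [|m IHm]; first by rewrite oplus0.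
rewrite iterS IHm succ_in_bar ?oplusA -?mulnDl ?addn1 //.
by rewrite (bar_rank a_inj a_img) rank_oplus (rank_a a_inj a_img).
Qed.

Lemma Pset_hP s h z : reflect (s <= rank z /\ (rank z = s -> D (a s) z < h * k))
  (z \in Pset_h a s h).
Proof.
have rs := rank_a a_inj a_img s.
rewrite inE Pset_rank inE andbC; apply: (iffP andP) => -[h1 h2]; split=> //.
  move=> zs; rewrite ltnNge; apply: contra h2 => hz.
  have /dvdnP[m e] : k %| D (a s) z by apply: dvd_dist; rewrite rs zs.
  have k0 : 0 < k := k_gt0 z.
  have md : m < d by have := dist_lt (a s) z; rewrite e ltn_mul2r => /andP[].
  apply/imsetP; exists (Ordinal md).
    by rewrite inE /=; move: hz; rewrite e leq_mul2r => /orP[/eqP k00|//]; rewrite k00 in k0.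
  by rewrite iter_succ_in_bar /= -e oplus_dist.
apply/negP => /imsetP[m]; rewrite inE iter_succ_in_bar => hm zE.
have k0 : 0 < k := k_gt0 z.
have := h2; rewrite zE rank_oplus rs dist_oplus; last by rewrite ltn_mul2r k0 ltn_ord.
by move=> /(_ erefl); rewrite ltnNge leq_mul2r hm orbT.
Qed.

(** [w] precedes [a s] in its class by [k] positions, so the interval holds the elements of P_s less
    than [k] before [a s]. For [d = 1], [w] is [a s] itself and the interval is all of P_s. *)
Lemma start_intervalP s z :
  reflect (s <= rank z /\ D z (a s) < k) (z \in start_interval a s).
Proof.
have rs := rank_a a_inj a_img s; have k0 : 0 < k := k_gt0 (a s).
have asP : a s \in Pset a s by rewrite Pset_rank inE rs.
set w := oplus (a s) (N - k).
have wP : w \in Pset a s.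
  by rewrite Pset_rank inE /w -[X in N - X]mul1n -mulnBl rank_oplus rs.
have [uP uH] := succ_inP wP; set u := succ_in _ _ in uP uH *.
have Nk : N = k \/ k + k <= N.
  have : 0 < N := leq_ltn_trans (leq0n w) (ltn_ord w).
  case: d => [|[|e]]; rewrite ?mul0n ?mul1n //; first by left.
  by move=> _; right; rewrite !mulSn addnA leq_addr.
rewrite /start_interval -/w -/u cintervalE // inE Pset_rank inE.
suff key : s <= rank z -> (D u z <= D u (a s)) = (D z (a s) < k).
  by apply: (iffP andP) => -[h1 h2]; move: h2; rewrite key.
move=> sz; have zP : z \in Pset a s by rewrite Pset_rank inE.
case: Nk => [Nk|Nk].
  have e0 : N - k = 0 by move: Nk; clear; lia.
  have wE : w = a s by rewrite /w e0 oplus0.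
  have -> : D z (a s) < k by move: (dist_lt z (a s)) Nk; clear; lia.
  have [->|zs] := eqVneq z (a s); first exact: leqnn.
  rewrite wE in uH; have [us uz] := uH z zP zs.
  rewrite (dist_sym (i := a s) (j := u)) 1?eq_sym //.
  move: (dist_shift (a s) u z) uz (dist_lt (a s) z) (dist_lt u z); clear; lia.
have kN : k < N by move: Nk k0; clear; lia.
have asE : oplus w k = a s by rewrite /w oplusA subnK ?oplusN // ltnW.
have Dwa : D w (a s) = k by rewrite -asE dist_oplus.
have aw : a s != w by apply: contraTneq k0 => e; rewrite -Dwa e distii.
have [uw ua] := uH (a s) asP aw.
have Dua : D w u + D u (a s) = k.
  move: (dist_shift w u (a s)) ua (dist_lt u (a s)) kN; rewrite Dwa; clear; lia.
have [->|zw] := eqVneq z w.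
  rewrite Dwa ltnn; apply/negbTE; rewrite -ltnNge (dist_sym (i := w) (j := u)) 1?eq_sym //.
  by move: Dua kN; clear; lia.
have [_ uz] := uH z zP zw; have zw0 := dist_gt0 zw.
move: (dist_shift w u z) (dist_shift w z (a s)) uz Dua kN zw0; rewrite Dwa.
move: (dist_lt u z) (dist_lt w z) (dist_lt z (a s)) => h1 h2 h3 h4 h5 h6 h7 h8 h9.
by apply/idP/idP; move: h1 h2 h3 h4 h5 h6 h7 h8 h9; clear; lia.
Qed.

Lemma Bcoll_arcset s I : I \in Bcoll a s ->
  #|I| = k /\ exists i l1 l2, I = arcset rank s i l1 l2.
Proof.
rewrite /Bcoll big_add1 big_mkord => /bigcupP[h _ /imsetP[i]].
rewrite inE => /andP[/start_intervalP[si ia] /eqP cI] ->; split=> //.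
have rs := rank_a a_inj a_img s; have k0 : 0 < k := k_gt0 i.
have iQ : i \in Pset_h a s h.+1.
  apply/Pset_hP; split=> // ri; have ka : k %| D i (a s) by apply: dvd_dist; rewrite rs.
  have /eqP/dist0 -> : D i (a s) == 0.
    by rewrite -leqn0 leqNgt; apply/negP => /dvdn_leq /(_ ka); rewrite leqNgt ia.
  by rewrite distii muln_gt0 k0.
have kQ : k <= #|Pset_h a s h.+1|.
  rewrite -{1}cI; apply/subset_leq_card/subsetP => x; rewrite inE.
  exact: mem_traject_succ_in.
have [_ [l lE]] := traject_succ_in iQ kQ.
(* The parameter is [h.+1] after reindexing: P_(s,h+1) keeps the class elements less than [h.+1 * k]
   past [a s], here measured from [i]. *)
exists i, (D i (a s) + h.+1 * k), l; rewrite /Iset lE; apply/setP => z.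
rewrite inE; apply/andP/arcsetP => [[/Pset_hP[h1 h2] h3]|[h1 [h2 h3]]].
  split=> //; split=> // zs; rewrite (dist_split ia) ?rs //.
  by rewrite ltn_add2l h2.
split=> //; apply/Pset_hP; split=> // zs; move: (h3 zs).
by rewrite (dist_split ia) ?rs // ltn_add2l.
Qed.

Lemma Jcoll_arc_family g p J : J \in Jcoll a g p -> arc_family rank k (k - g) J.
Proof.
case/bigcupP => s /andP[gs _] /bigcupP[t _ /imsetP[I /Bcoll_arcset[cI [i [l1 [l2 IE]]]] ->]].
split; first by rewrite card_oplus_set.
by rewrite IE arcset_oplus; exists s, (oplus i (t * k)), l1, l2.
Qed.

End Bridge.

Lemma initial_segment_eq N (Q : {set 'I_N}) (i : 'I_N) l l' :
  #|[set z in Q | dist N i z < l]| = #|[set z in Q | dist N i z < l']| ->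
  [set z in Q | dist N i z < l] = [set z in Q | dist N i z < l'].
Proof.
wlog ll : l l' / l <= l'.
  by move=> H e; case: (leqP l l') => [|/ltnW] h; [|symmetry]; apply: H.
move=> e; apply/eqP; rewrite eqEcard e leqnn andbT; apply/subsetP => z.
by rewrite !inE => /andP[-> /leq_trans->].
Qed.

(** * Recovering the construction from arc sets *)

Section Back.

Variables (d k : nat) (a : 'I_k -> 'I_(d * k)).
Hypothesis a_inj : injective a.
Hypothesis a_img : [set a i | i : 'I_k] = [set x : 'I_(d * k) | (x < k)%N].

Local Notation N := (d * k).
Local Notation D := (dist N).
Local Notation rank := (rank a).

Lemma arcset_start s (i i' : 'I_N) l1 l2 : l2 <= N ->
  i' \in arcset rank s i l1 l2 ->
  (forall z, z \in arcset rank s i l1 l2 -> D i i' <= D i z) ->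
  arcset rank s i l1 l2 = arcset rank s i' (l1 - D i i') (l2 - D i i').
Proof.
move=> l2N i'J imin; apply/setP => z; apply/idP/arcsetP => [zJ|[h1 [h2 h3]]].
  have /arcsetP[h1 [h2 h3]] := zJ; have iz := imin z zJ.
  have zE : D i i' + D i' z = D i z.
    by move: (dist_shift i i' z) (dist_lt i' z) (dist_lt i z) iz; clear; lia.
  split=> //; split=> [|/h3]; first by move: iz zE h2; clear; lia.
  by move: iz zE; clear; lia.
have zE : D i i' + D i' z = D i z.
  move: (dist_shift i i' z) h2 l2N (dist_lt i z); clear; lia.
apply/arcsetP; split=> //; split=> [|/h3]; first by move: zE h2; clear; lia.
by move: zE; clear; lia.
Qed.

(** When rank [s] does not occur in the set, its bound [l1] cuts nothing, and the new least rank is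
    cut only by [l2]. *)
Lemma arcset_min_rank s (i b : 'I_N) l1 l2 : b \in arcset rank s i l1 l2 ->
  (forall z, z \in arcset rank s i l1 l2 -> rank b <= rank z) ->
  exists l, arcset rank s i l1 l2 = arcset rank (rank b) i l l2.
Proof.
move=> bJ bmin; have /arcsetP[sb _] := bJ.
have [e|ne] := eqVneq (rank b) s; first by exists l1; rewrite e.
have {ne sb} sb : s < rank b by rewrite ltn_neqAle eq_sym ne.
exists l2; apply/setP => z; apply/idP/arcsetP => [zJ|[h1 [h2 _]]].
  by have /arcsetP[_ [h _]] := zJ; split; [exact: bmin|].
apply/arcsetP; split; first exact: leq_trans (ltnW sb) h1.
by split=> // e; move: (leq_trans sb h1); rewrite e ltnn.
Qed.

Lemma arcset_Bcoll (s : 'I_k) (i : 'I_N) l1 l2 :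
  #|arcset rank s i l1 l2| = k -> D i (a s) < k -> s <= rank i ->
  a s \in arcset rank s i l1 l2 -> arcset rank s i l1 l2 \in Bcoll a s.
Proof.
move=> cJ ia si; have rs := rank_a a_inj a_img s.
have k0 : 0 < k := k_gt0 i.
have d0 : 0 < d.
  have : 0 < N := leq_ltn_trans (leq0n i) (ltn_ord i).
  by rewrite muln_gt0 => /andP[].
case/arcsetP=> _ [al2 /(_ rs) al1].
(* [P m] says that [a s] moved by [m * k] is in the arc set. The first failure [h], capped at [d],
   is the parameter of P_(s,h). *)
pose P m := (D i (a s) + m * k < l1) && (D i (a s) + m * k < l2).
have exP : exists m, (m == d) || ~~ P m by exists d; rewrite eqxx.
have [h hP hmin] := ex_minnP exP.
have hd : h <= d by apply: hmin; rewrite eqxx.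
have h0 : 0 < h.
  rewrite lt0n; apply: contraTneq hP => ->.
  by rewrite /P mul0n addn0 al1 al2 orbF eq_sym -lt0n.
have PE m : m < d -> (m < h) = P m.
  move=> md; apply/idP/idP => [mh|Pm].
    by apply/negPn/negP => nP; have := hmin m; rewrite nP orbT leqNgt mh => /(_ isT).
  rewrite ltnNge; apply/negP => hm; move: hP; rewrite (ltn_eqF (leq_ltn_trans hm md)) /=.
  case/negP; case/andP: Pm => p1 p2.
  have le : D i (a s) + h * k <= D i (a s) + m * k by rewrite leq_add2l leq_mul2r hm orbT.
  by rewrite /P !(leq_ltn_trans le).
have JQ : arcset rank s i l1 l2 = [set z in Pset_h a s h | D i z < l2].
  have multE z : rank z = s -> exists2 m, m < d & D (a s) z = m * k.
    move=> zs; have /dvdnP[m e] : k %| D (a s) z.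
      by apply: (dvd_dist a_inj a_img); rewrite rs zs.
    by exists m => //; have := dist_lt (a s) z; rewrite e ltn_mul2r => /andP[].
  apply/setP => z; rewrite [RHS]inE.
  apply/arcsetP/andP => [[h1 [h2 h3]]|[/(Pset_hP a_inj a_img)[h1 h3] h2]].
    split=> //; apply/(Pset_hP a_inj a_img); split=> // zs; have [m md mE] := multE z zs.
    move: (h3 zs) h2; rewrite (dist_split a_inj a_img ia) ?rs // mE => p1 p2.
    by rewrite ltn_mul2r k0 /= PE // /P p1 p2.
  split=> //; split=> // zs; have [m md mE] := multE z zs.
  move: (h3 zs); rewrite (dist_split a_inj a_img ia) ?rs // mE.
  by rewrite ltn_mul2r k0 /= PE // => /andP[].
have iQ : i \in Pset_h a s h.
  have : i \in arcset rank s i l1 l2.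
    apply/arcsetP; rewrite distii; split=> //.
    by split=> [|_]; [exact: leq_ltn_trans al2|exact: leq_ltn_trans al1].
  by rewrite JQ inE => /andP[].
have kQ : k <= #|Pset_h a s h|.
  by rewrite -[X in X <= _]cJ JQ; apply/subset_leq_card/subsetP => z; rewrite inE => /andP[].
have [cI [l lE]] := traject_succ_in iQ kQ.
(* Both sides are initial segments of P_(s,h) from [i], of the same size [k]. *)
have IE : arcset rank s i l1 l2 = Iset a s i h.
  by rewrite JQ /Iset lE; apply: initial_segment_eq; rewrite -JQ -lE cI.
rewrite IE /Bcoll big_add1 big_mkord; apply/bigcupP.
have hd' : h.-1 < d by rewrite prednK.
exists (Ordinal hd') => //=; apply/imsetP; exists i; last by rewrite prednK.
rewrite inE prednK // -IE cJ eqxx andbT.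
by apply/(start_intervalP a_inj a_img).
Qed.

(** The set is normalised: [s] becomes the least rank present, [i] its first element, and a rotation
    by a multiple of [k] brings its first element of rank [s] to [a s]. *)
Lemma arc_family_Jcoll g (p c : int) J :
  (k%:Z = d%:Z * p + c)%R -> (c = -1 \/ c = 0 \/ c = 1)%R ->
  (d = 1 -> c = 0%R) -> 0 < k ->
  arc_family rank k (k - g) J -> J \in Jcoll a g p.
Proof.
move=> kE cE d1 k0 [cJ [s0 [i0 [l1 [l2 [gs0]]]]]].
rewrite arcset_min; move: (minn l2 N) (geq_minr l2 N) (minn l1 (minn l2 N)) => {}l2 l2N {}l1 JE.
have /card_gt0P[x xJ] : 0 < #|J| by rewrite cJ.
have [b bJ bmin] := @arg_minnP _ x (fun z => z \in J) rank xJ.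
rewrite JE in bJ bmin; have [s0b _] := arcsetP _ _ _ _ _ _ bJ.
have [l lE] := arcset_min_rank bJ bmin.
have {}gs0 : k - g <= rank b := leq_trans gs0 s0b.
rewrite {}lE in bJ JE {bmin}.
pose s := Ordinal (rank_lt a_img b).
have [i iJ imin] := @arg_minnP _ x (fun z => z \in J) (D i0) xJ.
rewrite JE in iJ imin.
have JE' := arcset_start l2N iJ imin; rewrite -JE in JE'.
move: (l - _) (l2 - _) JE' => m1 m2 JE'; rewrite -JE in iJ bJ.
rewrite -/(nat_of_ord s) in JE' gs0.
have PB : (b \in J) && (rank b == s) by rewrite bJ /= eqxx.
have [e /andP[eJ /eqP es] emin] :=
  @arg_minnP _ b (fun z => (z \in J) && (rank z == s)) (D i) PB.
have rs := rank_a a_inj a_img s.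
have /arcsetP[_ [e2 /(_ es) e1]] : e \in arcset rank s i m1 m2 by rewrite -JE'.
have /arcsetP[si _] : i \in arcset rank s i m1 m2 by rewrite -JE'.
(* Otherwise [e] moved back by [k] would be an earlier element of rank [s] in [J]. *)
have ek : D i e < k.
  rewrite ltnNge; apply/negP => ke; pose e' := oplus i (D i e - k).
  have e'E : oplus e' (1 * k) = e by rewrite oplusA mul1n subnK // oplus_dist.
  have De' : D i e' = D i e - k.
    by rewrite dist_oplus // (leq_ltn_trans (leq_subr _ _)) ?dist_lt.
  have De : D i e' < D i e by rewrite De'; move: ke k0; clear; lia.
  have re' : rank e' = s by rewrite -(rank_oplus a_inj a_img e' 1) e'E.
  have : e' \in J.
    rewrite JE'; apply/arcsetP; rewrite re'; split=> //.
    by split=> [|_]; [exact: ltn_trans e2|exact: ltn_trans e1].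
  by move=> e'J; have := emin e'; rewrite e'J re' eqxx leqNgt De => /(_ isT).
have /dvdnP[t tE] : k %| D (a s) e by apply: (dvd_dist a_inj a_img); rewrite rs es.
have td : t < d by have := dist_lt (a s) e; rewrite tE ltn_mul2r => /andP[].
have eE : oplus (a s) (t * k) = e by rewrite -tE oplus_dist.
pose i1 := oplus i ((d - t) * k).
have i1E : oplus i1 (t * k) = i.
  by rewrite oplusA -mulnDl subnK ?oplusN // ltnW.
have JJ : J = oplus_set (arcset rank s i1 m1 m2) (t * k).
  by rewrite (arcset_oplus a_inj a_img) i1E.
have i1a : D i1 (a s) = D i e by rewrite -(dist_oplus2 _ _ (t * k)) i1E eE.
apply/bigcupP; exists s; last first.
  apply/bigcupP; exists (Ordinal td) => //=; rewrite JJ; apply: imset_f.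
  apply: arcset_Bcoll; rewrite ?i1a //.
  - by rewrite -(card_oplus_set _ (t * k)) -JJ.
  - by rewrite (rank_oplus a_inj a_img).
  - by apply/arcsetP; rewrite rs i1a.
rewrite gs0 andTb.
(* [J] lies in P_s. The bound gives [c <= d * (k - s - p)]; as [c >= -1], and [c = 0] if [d = 1],
   the second factor is nonnegative, which is the upper bound on [s] in [Jcoll]. *)
have : k <= d * (k - s).
  rewrite -(card_rank_ge a_inj a_img (ltnW (ltn_ord s))) -[X in X <= _]cJ JE'.
  by apply/subset_leq_card/subsetP => z /arcsetP[h _]; rewrite inE.
move: (ltn_ord s) kE cE d1; move: (nat_of_ord s) => r; clear => rk kE cE d1 h.
have {}h : (k%:Z <= d%:Z * (k%:Z - r%:Z))%R by lia.
suff : (0 <= k%:Z - r%:Z - p)%R by lia.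
have {}h : (c <= d%:Z * (k%:Z - r%:Z - p))%R by rewrite GRing.mulrBr; lia.
move: h; move: (k%:Z - r%:Z - p)%R => y h.
have [e|d2] : d = 1 \/ d <> 1 by lia.
  by rewrite e GRing.mul1r (d1 e) in h.
have [y0|y0] : (y <= -1)%R \/ (0 <= y)%R by lia.
  have [d0|{}d2] : d = 0 \/ 2 <= d by lia.
    by rewrite d0 GRing.mul0r in kE h; lia.
  have : (d%:Z * y <= - d%:Z)%R by nia.
  by lia.
by [].
Qed.

End Back.

(** * Transfer to [n] *)

Lemma crossing_imset n N (F : 'I_n -> 'I_N) (I J : {set 'I_n}) :
  {mono F : x y / x < y} -> crossing (F @: I) (F @: J) = crossing I J.
Proof.
move=> Fmono.
have Finj : injective F.
  move=> x y e; apply/ord_inj/eqP; rewrite eqn_leq [x <= y]leqNgt [y <= x]leqNgt.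
  by rewrite -(Fmono x y) -(Fmono y x) e ltnn.
have cycF w x y z : cyclic4 (F w) (F x) (F y) (F z) = cyclic4 w x y z.
  by rewrite /cyclic4; congr [|| [&& _, _ & _], [&& _, _ & _], [&& _, _ & _]
    | [&& _, _ & _]]; apply: Fmono.
have DF (A B : {set 'I_n}) x : (F x \in F @: A :\: F @: B) = (x \in A :\: B).
  by rewrite !inE !mem_imset.
apply/crossingP/crossingP => -[w [x [y [z [wI xJ yI zJ h]]]]]; last first.
  by exists (F w), (F x), (F y), (F z); rewrite !DF cycF.
have /setDP[/imsetP[w' _ e1] _] := wI; have /setDP[/imsetP[x' _ e2] _] := xJ.
have /setDP[/imsetP[y' _ e3] _] := yI; have /setDP[/imsetP[z' _ e4] _] := zJ.
by exists w', x', y', z'; move: wI xJ yI zJ h; rewrite e1 e2 e3 e4 !DF cycF.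
Qed.

Lemma oplus_set_inj N t : injective (fun I : {set 'I_N} => oplus_set I t).
Proof.
apply: imset_inj => x y e; apply: (@dist_inj _ x).
by rewrite -(dist_oplus2 x y t) -e !distii.
Qed.

Section Transfer.

Variables (k n g d : nat) (a : 'I_k -> 'I_(d * k)) (F : 'I_n -> 'I_(d * k)).
Hypotheses (k_gt0 : 0 < k) (gk : g %| k) (n_eq : n = d * g).
Hypothesis a_inj : injective a.
Hypothesis a_img : [set a i | i : 'I_k] = [set x : 'I_(d * k) | (x < k)%N].
Hypothesis a_last :
  [set a i | i : 'I_k & (k - g <= i)%N] = [set x : 'I_(d * k) | (x < g)%N].
Hypothesis F_eq : forall j : 'I_n, F j = j %% g + j %/ g * k :> nat.

Local Notation rank := (rank a).
Local Notation family := (arc_family rank k (k - g)).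

Lemma g_gt0 : 0 < g. Proof. exact: dvdn_gt0 gk. Qed.

Lemma g_le_k : g <= k. Proof. exact: dvdn_leq. Qed.

Lemma modg_lt_k m : m %% g < k.
Proof. by rewrite (leq_trans _ g_le_k) // ltn_pmod // g_gt0. Qed.

Lemma F_mono : {mono F : x y / x < y}.
Proof.
have imp (x y : 'I_n) : x < y -> F x < F y.
  move=> xy; rewrite !F_eq; have : x %/ g <= y %/ g by rewrite leq_div2r // ltnW.
  rewrite leq_eqVlt => /orP[/eqP e|lt].
    by move: xy; rewrite {1}(divn_eq x g) {1}(divn_eq y g) e ltn_add2l ltn_add2r.
  apply: (@leq_trans ((x %/ g).+1 * k)).
    by rewrite mulSn ltn_add2r modg_lt_k.
  by rewrite (leq_trans _ (leq_addl _ _)) // leq_mul2r lt orbT.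
move=> x y; apply/idP/idP => [h|/imp//]; rewrite ltnNge leq_eqVlt.
by apply/negP => /orP[/eqP/ord_inj e|/imp]; [rewrite e ltnn in h|rewrite ltnNge ltnW].
Qed.

Lemma F_inj : injective F.
Proof.
move=> x y e; apply/ord_inj/eqP; rewrite eqn_leq [x <= y]leqNgt [y <= x]leqNgt.
by rewrite -(F_mono x y) -(F_mono y x) e ltnn.
Qed.

(** By [a_last] the residues below [g] have the last [g] ranks, so ranks from [k - g] on describe
    the image of [F]. *)
Lemma rank_last y : (k - g <= rank y) = (y %% k < g).
Proof.
have [s -> sy] := rankP a_img y; rewrite -sy.
have -> : (a s < g) = (a s \in [set x : 'I_(d * k) | x < g]) by rewrite inE.
rewrite -a_last; apply/idP/imsetP => [h|[i]]; first by exists s; rewrite ?inE.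
by rewrite inE => h /a_inj ->.
Qed.

Lemma rank_F j : k - g <= rank (F j).
Proof. by rewrite rank_last F_eq addnC modnMDl modn_small ?modg_lt_k // ltn_pmod // g_gt0. Qed.

Lemma F_onto y : k - g <= rank y -> exists j, F j = y.
Proof.
rewrite rank_last => yg; have yd : y %/ k < d by rewrite ltn_divLR.
have h : y %/ k * g + y %% k < n.
  rewrite n_eq; apply: (@leq_trans ((y %/ k).+1 * g)); first by rewrite mulSn addnC ltn_add2r.
  by rewrite leq_mul2r yd orbT.
exists (Ordinal h); apply: ord_inj.
rewrite F_eq /= modnMDl modn_small // divnMDl ?g_gt0 // (divn_small yg) addn0.
by rewrite addnC -divn_eq.
Qed.

Lemma preimsetK J : family J -> F @: (F @^-1: J) = J.
Proof.
move=> [_ [s [i [l1 [l2 [gs ->]]]]]]; apply/setP => y; apply/imsetP/idP.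
  by move=> [j]; rewrite inE => jJ ->.
move=> yJ; have [j je] : exists j, F j = y.
  by apply: F_onto; have /arcsetP[h _] := yJ; apply: leq_trans h.
by exists j => //; rewrite inE je.
Qed.

Lemma card_preimset J : family J -> #|F @^-1: J| = k.
Proof.
move=> hJ; have [cJ _] := hJ; rewrite -[RHS]cJ -{2}(preimsetK hJ).
by rewrite card_imset //; apply: F_inj.
Qed.

Lemma imsetK (X : {set 'I_n}) : F @^-1: (F @: X) = X.
Proof. by apply/setP => x; rewrite inE mem_imset //; apply: F_inj. Qed.

(** Adding [k] to [b + g * x] adds [k %/ g] to [x] modulo [d], hence [k %/ g * k] to the image. *)
Lemma F_oplus j : F (oplus j k) = oplus (F j) (k %/ g * k).
Proof.
apply: ord_inj; rewrite F_eq /= F_eq.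
have e1 : (j + k) %% n %% g = j %% g.
  rewrite modn_dvdm; last by rewrite n_eq dvdn_mull.
  by rewrite -modnDmr (eqP gk) addn0.
have e2 : (j + k) %% n %/ g = (j %/ g + k %/ g) %% d.
  have e m : m %% n %/ g = (m %/ g) %% d by rewrite n_eq -modn_divl.
  by rewrite e divnDr.
rewrite e1 e2; set y := j %% g + _ + _.
have yE : y = (j %/ g + k %/ g) * k + j %% g by rewrite /y mulnDl [RHS]addnC addnA.
rewrite [RHS](divn_eq _ k) -modn_divl modn_dvdm ?dvdn_mull // yE.
rewrite divnMDl // modnMDl (modn_small (modg_lt_k j)).
by rewrite (divn_small (modg_lt_k j)) addn0 addnC.
Qed.

Lemma family_oplus J t : family J -> family (oplus_set J (t * k)).
Proof.
move=> [cJ [s [i [l1 [l2 [gs JE]]]]]]; split; first by rewrite card_oplus_set.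
exists s, (oplus i (t * k)), l1, l2; split=> //.
by rewrite JE; apply: (arcset_oplus a_inj a_img).
Qed.

Lemma preimset_oplus J : family J ->
  oplus_set (F @^-1: J) k = F @^-1: oplus_set J (k %/ g * k).
Proof.
move=> hJ; apply/eqP; rewrite eqEcard card_oplus_set !card_preimset //.
  rewrite leqnn andbT; apply/subsetP => y /imsetP[j]; rewrite inE => jJ ->.
  by rewrite inE F_oplus; apply: imset_f.
exact: family_oplus.
Qed.

End Transfer.

Theorem theorem5p4 (k n g d : nat) (p c : int)
    (a : 'I_k -> 'I_(d * k)) (F : 'I_n -> 'I_(d * k)) :
  (1 <= k)%N -> (k <= n)%N ->
  g = gcdn k n -> d = (n %/ g)%N ->
  (k%:Z = d%:Z * p + c)%R ->
  (c = -1 \/ c = 0 \/ c = 1)%R ->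
  (d = 1%N -> c = 0%R) ->
  injective a ->
  [set a i | i : 'I_k] = [set x : 'I_(d * k) | (x < k)%N] ->
  [set a i | i : 'I_k & (k - g <= i)%N] = [set x : 'I_(d * k) | (x < g)%N] ->
  (forall (j : 'I_n) (b x : nat), (b < g)%N -> (x < d)%N ->
     nat_of_ord j = (b + g * x)%N -> nat_of_ord (F j) = (b + k * x)%N) ->
  let I' := [set F @^-1: J | J : {set 'I_(d * k)} in Jcoll a g p] in
  symmetric_collection k I' /\ maximal_noncrossing_collection k I'.
Proof.
move=> k0 kn gE dE kE cE d1 a_inj a_img a_last F_def I'.
have gk : g %| k by rewrite gE dvdn_gcdl.
have n_eq : n = d * g by rewrite dE divnK // gE dvdn_gcdr.
have F_eq (j : 'I_n) : F j = j %% g + j %/ g * k :> nat.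
  have g0 := dvdn_gt0 k0 gk.
  rewrite [j %/ g * k]mulnC; apply: F_def; first by rewrite ltn_pmod.
    by rewrite ltn_divLR // -n_eq.
  by rewrite addnC mulnC -divn_eq.
have mem_I' I : reflect
    (exists2 J, arc_family (rank a) k (k - g) J & I = F @^-1: J) (I \in I').
  apply: (iffP imsetP) => -[J hJ ->]; exists J => //.
    exact: Jcoll_arc_family hJ.
  exact: (arc_family_Jcoll a_inj a_img kE cE d1 k0 hJ).
have Fmono := F_mono k0 gk F_eq.
have preimK := preimsetK k0 gk n_eq a_inj a_img a_last F_eq.
split.
  apply/eqP; rewrite eqEcard (card_imset _ (@oplus_set_inj n k)) leqnn andbT.
  apply/subsetP => _ /imsetP[_ /mem_I'[J hJ ->] ->]; apply/mem_I'.
  exists (oplus_set J (k %/ g * k)); first exact: family_oplus.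
  exact: (preimset_oplus k0 gk n_eq a_inj a_img a_last F_eq).
apply/maxsetP; split.
  apply/andP; split.
    apply/forall_inP => _ /mem_I'[J hJ ->]; apply/eqP.
    exact: (card_preimset k0 gk n_eq a_inj a_img a_last F_eq).
  apply/forall_inP => _ /mem_I'[J hJ ->]; apply/forall_inP => _ /mem_I'[J' hJ' ->].
  rewrite -(crossing_imset _ _ Fmono) !preimK //.
  exact: arc_family_not_crossing hJ hJ'.
move=> C /andP[/forall_inP cardC /forall_inP noC] I'C.
apply/eqP; rewrite eqEsubset I'C andbT; apply/subsetP => X XC; apply/mem_I'.
(* As [F] preserves crossings, the image of [X] crosses no member of the arc family, and maximality
   on the larger circle applies. *)
exists (F @: X); last by rewrite (imsetK k0 gk F_eq).
apply: (arc_family_maximal a_inj a_img kE cE d1 k0).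
- by rewrite card_imset; [apply/eqP/cardC|exact: (F_inj k0 gk F_eq)].
- by move=> _ /imsetP[j _ ->]; apply: (rank_F k0 gk a_inj a_img a_last F_eq).
move=> J hJ; rewrite -(preimK J hJ) (crossing_imset _ _ Fmono).
by have /forall_inP := noC X XC; apply; apply: (subsetP I'C); apply/mem_I'; exists J.
Qed.
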